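(* Let $k\geq1$ be an integer and let $(M,g)$ be a Riemannian manifold of even dimension $n=2p\geq4k$ satisfying one of the following two conditions: (1) ($2k$-Thorpe) $\star\bigl(g^{p-2k}R^k\bigr)=g^{p-2k}R^k$; (2) ($2k$-anti-Thorpe) $\star\bigl(g^{p-2k}R^k\bigr)+g^{p-2k}R^k=\lambda g^p$ for some constant $\lambda$. Then the Gauss–Kronecker tensor $R^k$ is a harmonic double form.
   Context: A $(p,q)$ double form on $M$ is a smooth section of $\Lambda^pT^*M\otimes\Lambda^qT^*M$, with exterior product $(\theta_1\otimes\theta_2).(\theta_3\otimes\theta_4)=(\theta_1\wedge\theta_3)\otimes(\theta_2\wedge\theta_4)$ (dot omitted). The metric $g$ is seen as a $(1,1)$ double form and the Riemann curvature tensor $R$ as a symmetric $(2,2)$ double form; $g^j$ and $R^k$ are powers for the exterior product. The interior product $\iota_\theta$ is the adjoint of left multiplication by $\theta$ for the inner product making $\{e^I\otimes e^J\}$ orthonormal for orthonormal $(e_i)$; the double Hodge star is $\star\omega=\frac1{n!}\iota_\omega g^n$, i.e. $\star(\theta_1\otimes\theta_2)=\star\theta_1\otimes\star\theta_2$ (independent of orientation). With $(e_i)$ a local orthonormal frame, $D\omega=\sum_i(e^i\otimes1).\nabla_{e_i}\omega$, $\delta\omega=-\sum_i\iota_{e_i\otimes1}\nabla_{e_i}\omega$, $\Delta=D\delta+\delta D$; $\omega$ is harmonic if $\Delta\omega=0$. *)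

(* Defs.v *)
From HB Require Import structures.
From mathcomp Require Import all_boot all_order all_algebra.
From mathcomp Require Import all_classical all_reals all_analysis.

Set Implicit Arguments.
Unset Strict Implicit.
Unset Printing Implicit Defensive.

Import Order.TTheory GRing.Theory Num.Theory.
Import numFieldNormedType.Exports.

Local Open Scope classical_set_scope.
Local Open Scope ring_scope.

(** ** The algebra of double forms on [R^n] *)

(* An element of the direct sum over p, q of Lambda^p (R^n)^* (x) Lambda^q
   (R^n)^*, given by its coordinates in the basis dx^I (x) dx^J, where dx^I is
   the exterior product of the dx^i, i \in I, taken in increasing order.  The
   (p, q) double forms are those supported on #|I| = p, #|J| = q. *)
Definition dform (R : realType) (n : nat) :=
  {ffun {set 'I_n} * {set 'I_n} -> R^o}.

Section DoubleForms.
Variables (R : realType) (n : nat).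
Implicit Types (w t : dform R n) (G E : 'M[R]_n) (v : 'rV[R]_n).

Definition dbase (I J : {set 'I_n}) : dform R n :=
  [ffun u : {set 'I_n} * {set 'I_n} => (u == (I, J))%:R].

(* For disjoint A and B, dx^A /\ dx^B = wsign A B *: dx^(A :|: B). *)
Definition wsign (A B : {set 'I_n}) : R :=
  (-1) ^+ #|[set ij : 'I_n * 'I_n |
             [&& ij.1 \in A, ij.2 \in B & (ij.2 < ij.1)%N]]%SET|.

(* (t1 (x) t2) . (t3 (x) t4) = (t1 /\ t3) (x) (t2 /\ t4) *)
Definition dmul w t : dform R n :=
  [ffun u : {set 'I_n} * {set 'I_n} =>
     \sum_(A in powerset u.1) \sum_(B in powerset u.2)
     wsign A (u.1 :\: A) * wsign B (u.2 :\: B) *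
     w (A, B) * t (u.1 :\: A, u.2 :\: B)].

Definition dunit : dform R n := dbase finset.set0 finset.set0.

Definition dpow w (k : nat) : dform R n := iter k (dmul w) dunit.

(* v (x) 1 and 1 (x) v, for the covector v = \sum_a v_a dx^a *)
Definition covl v : dform R n :=
  \sum_(a < n) v 0 a *: dbase [set a]%SET finset.set0.
Definition covr v : dform R n :=
  \sum_(a < n) v 0 a *: dbase finset.set0 [set a]%SET.

(* Contraction of the first (resp. second) factor with the vector d/dx^i; this
   does not involve a metric. *)
Definition contrl (i : 'I_n) w : dform R n :=
  [ffun u : {set 'I_n} * {set 'I_n} => if i \in u.1 then 0
             else wsign [set i]%SET u.1 * w ((i |: u.1)%SET, u.2)].
Definition contrr (i : 'I_n) w : dform R n :=
  [ffun u : {set 'I_n} * {set 'I_n} => if i \in u.2 then 0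
             else wsign [set i]%SET u.2 * w (u.1, (i |: u.2)%SET)].

(* The action on double forms of the algebra morphism of exterior algebras
   sending dx^a to \sum_i P a i dx^i. *)
Definition dsubst (P : 'M[R]_n) w : dform R n :=
  \sum_(u : {set 'I_n} * {set 'I_n})
    w u *: dmul (foldr (fun a => dmul (covl (row a P))) dunit (enum u.1))
                (foldr (fun a => dmul (covr (row a P))) dunit (enum u.2)).

(** ** Euclidean double forms: the scalar product on [R^n] has Gram matrix G *)

(* Columns are the coordinates of an orthonormal basis (e_i).  Such a basis
   exists whenever G is symmetric positive definite; everything below is
   independent of the basis that is picked. *)
Definition onb G : 'M[R]_n := xget 1%:M [set E | E^T *m G *m E = 1%:M].

(* The covector e^i of the dual basis *)
Definition dual_basis G (i : 'I_n) : 'rV[R]_n := row i (invmx (onb G)).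

(* The coordinate of w on e^I (x) e^J; indeed dx^a = \sum_i (onb G) a i e^i. *)
Definition onb_coord G w (I J : {set 'I_n}) : R := dsubst (onb G) w (I, J).

Definition onb_form G (I J : {set 'I_n}) : dform R n :=
  dsubst (invmx (onb G)) (dbase I J).

(* The inner product making the e^I (x) e^J orthonormal *)
Definition inner G w t : R :=
  \sum_(I : {set 'I_n}) \sum_(J : {set 'I_n})
    onb_coord G w I J * onb_coord G t I J.

(* iota_t, the adjoint of w |-> dmul t w *)
Definition iota_form G t w : dform R n :=
  \sum_(I : {set 'I_n}) \sum_(J : {set 'I_n})
    inner G w (dmul t (onb_form G I J)) *: onb_form G I J.

Definition metric_form G : dform R n :=
  \sum_(i < n) \sum_(j < n) G i j *: dbase [set i]%SET [set j]%SET.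

Definition dstar G w : dform R n :=
  (n`!%:R)^-1 *: iota_form G w (dpow (metric_form G) n).

End DoubleForms.

(** ** Double form fields on an open set of [R^n], for a metric g *)

Section LocalFields.
Variables (R : realType) (n : nat).
Implicit Types (g : 'rV[R]_n -> 'M[R]_n) (w : 'rV[R]_n -> dform R n).

Definition partial (a : 'I_n) (f : 'rV[R]_n -> R) : 'rV[R]_n -> R :=
  fun x => 'D_(delta_mx 0 a) f x.

(* C^infinity: every iterated partial derivative is differentiable on U. *)
Definition smooth_on (U : set 'rV[R]_n) (f : 'rV[R]_n -> R) : Prop :=
  forall (s : seq 'I_n) (x : 'rV[R]_n), U x ->
    differentiable (foldr partial f s) x.

(* Gamma^c_ab *)
Definition christoffel g (c a b : 'I_n) : 'rV[R]_n -> R := fun x =>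
  2^-1 * \sum_(d < n) invmx (g x) c d *
    (partial a (fun y => g y d b) x + partial b (fun y => g y d a) x
     - partial d (fun y => g y a b) x).

(* The component along d_d of R(d_a, d_b) d_c, where
   R(X, Y) = [nabla_X, nabla_Y] - nabla_[X, Y] *)
Definition curvature g (d c a b : 'I_n) : 'rV[R]_n -> R := fun x =>
  partial a (christoffel g d b c) x - partial b (christoffel g d a c) x
  + \sum_(m < n) (christoffel g d a m x * christoffel g m b c x
                  - christoffel g d b m x * christoffel g m a c x).

(* The value at ((d_i, d_j), (d_k, d_l)) is <R(d_i, d_j) d_l, d_k>: the sign is
   such that R = g^2 / 2 on the unit sphere. *)
Definition riemann_form g : 'rV[R]_n -> dform R n := fun x =>
  \sum_(i < n) \sum_(j < n | (i < j)%N) \sum_(k < n) \sum_(l < n | (k < l)%N)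
    (\sum_(m < n) g x k m * curvature g m l i j x)
      *: dbase _ [set i; j]%SET [set k; l]%SET.

(* The covariant derivative along d_a: the derivation extending
   nabla_a dx^i = - \sum_b Gamma^i_ab dx^b in both factors. *)
Definition nabla g (a : 'I_n) w : 'rV[R]_n -> dform R n := fun x =>
  [ffun u => partial a (fun y => w y u) x]
  - \sum_(i < n) \sum_(b < n) christoffel g i a b x *:
      (dmul (dbase _ [set b]%SET finset.set0) (contrl i (w x))
       + dmul (dbase _ finset.set0 [set b]%SET) (contrr i (w x))).

(* The covariant derivative along the vector e_i of the orthonormal basis at x.
   As nabla is tensorial in the direction, no regularity in x of the choice of
   the basis is involved here nor in D and delta. *)
Definition nabla_onb g (i : 'I_n) w : 'rV[R]_n -> dform R n := fun x =>
  \sum_(a < n) onb (g x) a i *: nabla g a w x.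

Definition D_form g w : 'rV[R]_n -> dform R n := fun x =>
  \sum_(i < n) dmul (covl (dual_basis (g x) i)) (nabla_onb g i w x).

Definition delta_form g w : 'rV[R]_n -> dform R n := fun x =>
  - \sum_(i < n) iota_form (g x) (covl (dual_basis (g x) i))
                           (nabla_onb g i w x).

Definition laplacian g w : 'rV[R]_n -> dform R n := fun x =>
  D_form g (delta_form g w) x + delta_form g (D_form g w) x.

End LocalFields.

(** ** Riemannian manifolds *)

(* A smooth manifold of dimension n, given by a smooth atlas: [chart_map a]
   is a homeomorphism from the open set [chart_dom a] of M onto the open set
   [chart_cod a] of R^n, with inverse [chart_inv a]; values outside these sets
   are irrelevant. *)
Record smoothManifold (R : realType) (n : nat) := SmoothManifold {
  carrier :> topologicalType;
  chart : Type;
  chart_dom : chart -> set carrier;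
  chart_cod : chart -> set 'rV[R]_n;
  chart_map : chart -> carrier -> 'rV[R]_n;
  chart_inv : chart -> 'rV[R]_n -> carrier;
  carrier_hausdorff : hausdorff_space carrier;
  carrier_second_countable : @second_countable carrier;
  chart_dom_open : forall a, open (chart_dom a);
  chart_cod_open : forall a, open (chart_cod a);
  chart_dom_cover : forall m, exists a, chart_dom a m;
  chart_map_cod : forall a m, chart_dom a m -> chart_cod a (chart_map a m);
  chart_inv_dom : forall a x, chart_cod a x -> chart_dom a (chart_inv a x);
  chart_mapK : forall a m, chart_dom a m -> chart_inv a (chart_map a m) = m;
  chart_invK : forall a x, chart_cod a x -> chart_map a (chart_inv a x) = x;
  chart_map_continuous : forall a, {in chart_dom a, continuous (chart_map a)};
  chart_inv_continuous : forall a, {in chart_cod a, continuous (chart_inv a)};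
  transition_smooth : forall a b (i : 'I_n),
    smooth_on (chart_map a @` (chart_dom a `&` chart_dom b))
              (fun x => chart_map b (chart_inv a x) 0 i) }.

(* [metric a x] is the Gram matrix of the coordinate vector fields of the chart
   a; as tangent vectors are row vectors here, the Jacobian acts on the right,
   whence the transformation rule. *)
Record riemannianManifold (R : realType) (n : nat) := RiemannianManifold {
  manifold :> smoothManifold R n;
  metric : chart manifold -> 'rV[R]_n -> 'M[R]_n;
  metric_smooth : forall a (i j : 'I_n),
    smooth_on (chart_cod a) (fun x => metric a x i j);
  metric_sym : forall a x, chart_cod a x -> (metric a x)^T = metric a x;
  metric_posdef : forall a x (v : 'rV[R]_n), chart_cod a x -> v != 0 ->
    0 < (v *m metric a x *m v^T) 0 0;
  metric_change : forall a b x,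
    (chart_map a @` (chart_dom a `&` chart_dom b)) x ->
    let tau := fun y => chart_map b (chart_inv a y) in
    metric a x = jacobian tau x *m metric b (tau x) *m (jacobian tau x)^T }.

Section ManifoldFields.
Variables (R : realType) (n : nat) (M : riemannianManifold R n).

(* A field of double forms, given by its coordinates in every chart. *)
Definition dfield := chart M -> 'rV[R]_n -> dform R n.

Implicit Types w t : dfield.

Definition eq_field w t : Prop :=
  forall a x, chart_cod a x -> w a x = t a x.

Definition mul_field w t : dfield := fun a x => dmul (w a x) (t a x).
Definition pow_field w (k : nat) : dfield := fun a x => dpow (w a x) k.
Definition add_field w t : dfield := fun a x => w a x + t a x.
Definition scale_field (c : R) w : dfield := fun a x => c *: w a x.
Definition zero_field : dfield := fun a x => 0.

Definition metric_field : dfield := fun a x => metric_form (metric a x).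
Definition riemann_field : dfield := fun a => riemann_form (metric a).

Definition star_field w : dfield := fun a x => dstar (metric a x) (w a x).

Definition is_harmonic w : Prop :=
  eq_field (fun a => laplacian (metric a) (w a)) zero_field.

(* g^(p - 2k) R^k, for 2k <= p *)
Definition thorpe_field (p k : nat) : dfield :=
  mul_field (pow_field metric_field (p - 2 * k)) (pow_field riemann_field k).

Definition thorpe (p k : nat) : Prop :=
  eq_field (star_field (thorpe_field p k)) (thorpe_field p k).

Definition anti_thorpe (p k : nat) : Prop :=
  exists lambda : R,
    eq_field (add_field (star_field (thorpe_field p k)) (thorpe_field p k))
             (scale_field lambda (pow_field metric_field p)).

End ManifoldFields.

Arguments metric_field {R n} M.
Arguments riemann_field {R n} M.

(* Main.v *)
From HB Require Import structures.
From mathcomp Require Import all_classical all_reals all_analysis.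
From mathcomp Require Import all_boot all_order all_algebra.
From mathcomp Require Import zify ring lra.
Require Import Defs.

Set Implicit Arguments.
Unset Strict Implicit.
Unset Printing Implicit Defensive.

Import Order.TTheory GRing.Theory Num.Theory.
Import numFieldNormedType.Exports.

Local Open Scope ring_scope.

(** Everything happens in one chart.  Write D and delta for the differential
    and codifferential in the first factor, T = g^(p - 2k) R^k, n = 2p.

    D is a graded derivation that kills the metric (the Levi-Civita connection
    is metric) and kills R (the second Bianchi identity, [D_riemann]); hence it
    kills R^k and T.  Both hypotheses say star T = e T + lambda g^p with e = 1 or
    e = -1.  The covariant derivative commutes with star and kills g^p, so
    star (nabla_a T) = e nabla_a T ([star_nabla]).  As star intertwines
    contraction and exterior product, up to sign
    e delta T = star (sum_a dx^a . nabla_a T) = star (D T) = 0 ([star_delta]).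

    It remains to divide by g^(p - 2k).  Since contracting g w with a vector in
    the first factor gives minus g times the contraction of w plus the exterior
    product of w by a covector of the second factor, delta (g w) = - g delta w
    as soon as w is killed by the differential in the second factor
    ([delta_form_metric_pow_mul]).  This applies to w = g^j R^k because R is
    symmetric ([dswap_riemann]), so that g^(p - 2k) delta (R^k) = 0.  Now
    delta (R^k) has bidegree (2k - 1, 2k), and multiplication by g^m is
    injective on bidegree (a, b) when a + b + 2m <= n + 1: the adjoint of g is
    the contraction, [contraction, g] = n - a - b, and one concludes by
    positivity ([metric_pow_mul_inj]).  Thus D (R^k) = 0 and delta (R^k) = 0.

    The star operator is never computed: by adjunction, star w is
    characterised by n! <star w, t> = <g^n, w t> for all t ([inner_star]), an
    identity that can be differentiated because nabla is compatible with the
    scalar product ([partial_inner]) and nabla g = 0.  All the algebra rests on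
    the operators of exterior product by dx^a and contraction by d/dx^a in each
    factor: they satisfy the canonical anticommutation relations, and the
    algebra is generated by the unit under the former, which is the induction
    principle [dform_ind]. *)

(** * Sums in a module *)

Lemma sum_delta (R : pzRingType) (V : lmodType R) (I : finType) (i : I) (F : I -> V) :
  \sum_j (i == j)%:R *: F j = F i.
Proof.
rewrite (bigD1 i) //= eqxx scale1r big1 ?addr0 // => j ji.
by rewrite eq_sym (negbTE ji) scale0r.
Qed.

Section FiniteSums.
Variables (R : numFieldType) (V : lmodType R).

Lemma eq_opp0 (v : V) : v = - v -> v = 0.
Proof.
move=> vN; apply/eqP; have /eqP : 2%:R *: v = 0.
  by rewrite scaler_nat mulr2n {1}vN addNr.
by rewrite scaler_eq0 pnatr_eq0.
Qed.

Variable n : nat.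
Implicit Types F : 'I_n -> 'I_n -> V.

Lemma antisym_sum0 F : (forall a b, F a b = - F b a) -> \sum_a \sum_b F a b = 0.
Proof.
move=> FN; apply: eq_opp0; rewrite {1}exchange_big -sumrN; apply: eq_bigr => a _.
by rewrite -sumrN; apply: eq_bigr => b _.
Qed.

Lemma sum_ltn_half F : (forall a b, F a b = F b a) -> (forall a, F a a = 0) ->
  \sum_(a < n) \sum_(b < n | (a < b)%N) F a b = 2^-1 *: \sum_a \sum_b F a b.
Proof.
move=> FC F0; have -> : \sum_a \sum_b F a b =
    \sum_(a < n) \sum_(b < n | (a < b)%N) F a b + \sum_(a < n) \sum_(b < n | (b < a)%N) F a b.
  rewrite -big_split; apply: eq_bigr => a _ /=.
  rewrite (bigID (fun b : 'I_n => (a < b)%N)) /=; congr (_ + _).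
  rewrite (bigD1 a) /= ?ltnn // F0 add0r; apply: eq_bigl => b.
  by rewrite -leqNgt ltn_neqAle andbC.
have -> : \sum_(a < n) \sum_(b < n | (b < a)%N) F a b =
    \sum_(a < n) \sum_(b < n | (a < b)%N) F a b.
  rewrite (exchange_big_dep predT) //=; apply: eq_bigr => a _.
  by apply: eq_bigr => b _.
rewrite scalerDr -scalerDl (_ : 2^-1 + 2^-1 = 1 :> R) ?scale1r //.
by field.
Qed.

Lemma sum4_swap (F : 'I_n -> 'I_n -> 'I_n -> 'I_n -> V) :
  \sum_i \sum_j \sum_k \sum_l F i j k l = \sum_k \sum_l \sum_i \sum_j F i j k l.
Proof.
under eq_bigr => i _ do rewrite exchange_big.
rewrite exchange_big; apply: eq_bigr => k _.
under eq_bigr => i _ do rewrite exchange_big.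
by rewrite exchange_big.
Qed.

Lemma sum3_rot (F : 'I_n -> 'I_n -> 'I_n -> V) :
  \sum_i \sum_j \sum_k F i j k = \sum_k \sum_i \sum_j F i j k.
Proof.
under eq_bigr => i _ do rewrite exchange_big.
by rewrite exchange_big.
Qed.

(** Each family appears twice with opposite signs, up to renaming two indices: the
    last step of the second Bianchi identity. *)
Lemma sum3_cancel (P Q : 'I_n -> 'I_n -> 'I_n -> V) :
  \sum_k \sum_l (\sum_c P c l k + \sum_c Q k c l - \sum_c P k l c - \sum_c Q k l c) = 0.
Proof.
under eq_bigr => k _ do rewrite !sumrB big_split.
rewrite !sumrB big_split /=.
have -> : \sum_k \sum_l \sum_c P c l k = \sum_k \sum_l \sum_c P k l c.
  rewrite exchange_big [RHS]exchange_big; apply: eq_bigr => l _ /=.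
  by rewrite exchange_big.
have -> : \sum_k \sum_l \sum_c Q k c l = \sum_k \sum_l \sum_c Q k l c.
  by apply: eq_bigr => k _; rewrite exchange_big.
by rewrite -addrA -opprD subrr.
Qed.

End FiniteSums.

(** * The exterior product of double forms *)

Section Product.
Variables (R : realType) (n : nat).
Implicit Types (w t s : dform R n) (A B C D I J : {set 'I_n}) (a b c : 'I_n).

Lemma dform_scaleE (k : R) w u : (k *: w) u = k * w u.
Proof. by rewrite ffunE. Qed.

Lemma dform_addE w t u : (w + t) u = w u + t u.
Proof. by rewrite ffunE. Qed.

Lemma dform_sumE (T : Type) (r : seq T) (P : pred T) (F : T -> dform R n) u :
  (\sum_(i <- r | P i) F i) u = \sum_(i <- r | P i) F i u.
Proof. by rewrite sum_ffunE. Qed.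

Lemma dbaseE I J u : dbase R I J u = (u == (I, J))%:R.
Proof. by rewrite ffunE. Qed.

Lemma dmulE w t u : dmul w t u =
  \sum_(A in powerset u.1) \sum_(B in powerset u.2)
    wsign R A (u.1 :\: A) * wsign R B (u.2 :\: B) *
    w (A, B) * t (u.1 :\: A, u.2 :\: B).
Proof. by rewrite ffunE. Qed.

Lemma dform_expand w : w = \sum_u w u *: dbase R u.1 u.2.
Proof.
apply/ffunP => u; rewrite dform_sumE (bigD1 u) //= big1 => [|v vu].
  by rewrite dform_scaleE dbaseE -surjective_pairing eqxx mulr1 addr0.
by rewrite dform_scaleE dbaseE -surjective_pairing eq_sym (negbTE vu) mulr0.
Qed.

Lemma dform_linear_ind (P : dform R n -> Prop) :
  (forall w t, P w -> P t -> P (w + t)) -> (forall k w, P w -> P (k *: w)) ->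
  (forall I J, P (dbase R I J)) -> forall w, P w.
Proof.
move=> PD PZ Pb w; rewrite (dform_expand w); apply: big_ind => //.
  by rewrite -(scale0r (dbase R set0 set0)); apply: PZ.
by move=> u _; apply: PZ.
Qed.

(** A product over pairs is multiplicative in A and in B, which a parity is not
    visibly. *)
Lemma wsign_prod A B :
  wsign R A B = \prod_(i in A) \prod_(j in B) (-1) ^+ (j < i)%N.
Proof.
rewrite pair_big_dep /= (bigID (fun p : 'I_n * 'I_n => p.2 < p.1)%N) /=.
rewrite [X in _ * X]big1 ?mulr1; last by move=> p /andP[_ /negbTE ->].
under eq_bigr => p /andP[_ ->] do rewrite expr1.
rewrite prodr_const /wsign cardsE; congr (_ ^+ _).
by apply: eq_card => p; rewrite unfold_in /= [RHS]unfold_in /= andbA.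
Qed.

Lemma wsignUl A B C : [disjoint A & B] ->
  wsign R (A :|: B) C = wsign R A C * wsign R B C.
Proof. by move=> dAB; rewrite !wsign_prod -bigU //; apply: eq_bigl => i; rewrite inE. Qed.

Lemma wsignUr A B C : [disjoint B & C] ->
  wsign R A (B :|: C) = wsign R A B * wsign R A C.
Proof.
move=> dBC; rewrite !wsign_prod -big_split; apply: eq_bigr => i _.
by rewrite -bigU //; apply: eq_bigl => j; rewrite inE.
Qed.

Lemma wsign0l B : wsign R set0 B = 1.
Proof. by rewrite wsign_prod big_set0. Qed.

Lemma wsign0r A : wsign R A set0 = 1.
Proof. by rewrite wsign_prod big1 // => i _; rewrite big_set0. Qed.

Lemma wsign11 a b : wsign R [set a] [set b] = (-1) ^+ (b < a)%N.
Proof. by rewrite wsign_prod !big_set1. Qed.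

Lemma wsign_sq A B : wsign R A B * wsign R A B = 1.
Proof. by rewrite -expr2 sqrr_sign. Qed.

(** dx^A /\ dx^B = eps A B dx^(A u B): the structure constants of the exterior
    algebra. *)
Definition eps A B : R := if [disjoint A & B] then wsign R A B else 0.

Lemma eps0l B : eps set0 B = 1.
Proof. by rewrite /eps disjoints_subset sub0set wsign0l. Qed.

Lemma eps0r A : eps A set0 = 1.
Proof. by rewrite /eps disjoint_sym disjoints_subset sub0set wsign0r. Qed.

(** Associativity of the exterior product, on basis elements. *)
Lemma eps_cocycle A B C :
  eps A B * eps (A :|: B) C = eps B C * eps A (B :|: C).
Proof.
rewrite /eps -!setI_eq0 setIUl setIUr !setU_eq0 !setI_eq0.
have [dAB|_] := boolP [disjoint A & B]; last by rewrite mul0r mulr0.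
have [dBC|_] := boolP [disjoint B & C]; last by rewrite andbF mulr0 mul0r.
rewrite andbT /=; case: ifP => _; last by rewrite !mulr0.
by rewrite wsignUl // wsignUr //; ring.
Qed.

Lemma eps1C a A : eps [set a] A = (-1) ^+ #|A| * eps A [set a].
Proof.
rewrite /eps disjoint_sym; case: ifP => dA; last by rewrite mulr0.
rewrite !wsign_prod big_set1.
under [X in _ = _ * X]eq_bigr => i _ do rewrite big_set1.
rewrite -prodr_const -big_split; apply: eq_bigr => i iA /=.
have: i != a.
  by apply: contraTneq dA => <-; rewrite disjoint_sym disjoints1 iA.
by rewrite -val_eqE /=; case: ltngtP => //= _ _; rewrite ?mulr1 ?mulrNN ?mulr1.
Qed.

(** In the coordinate at (U, V) of the product, only one decomposition of U and
    one of V contribute; the two factors do not interact. *)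
Lemma dmul_base A B C D : dmul (dbase R A B) (dbase R C D) =
  (eps A C * eps B D) *: dbase R (A :|: C) (B :|: D).
Proof.
have half U (X Y : {set 'I_n}) :
    \sum_(Z in powerset U) wsign R Z (U :\: Z) * ((Z == X)%:R * (U :\: Z == Y)%:R)
    = eps X Y * (U == X :|: Y)%:R.
  have [sXU|nsXU] := boolP (X \in powerset U); last first.
    rewrite big1 => [|Z ZU]; last first.
      have/negbTE-> : Z != X by apply: contraNneq nsXU => <-.
      by rewrite mul0r mulr0.
    case: eqP => [E|_]; last by rewrite mulr0.
    by move: nsXU; rewrite powersetE E subsetUl.
  rewrite (bigD1 X) //= big1 ?addr0 => [|Z /andP[_ /negbTE->]]; last by rewrite mul0r mulr0.
  rewrite eqxx mul1r /eps; move: sXU; rewrite powersetE => sXU.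
  have [<-|nY] := eqVneq (U :\: X) Y.
    have -> : [disjoint X & U :\: X] by rewrite disjoints_subset setCD subsetUr.
    have -> : X :|: (U :\: X) = U.
      by apply/setP => i; rewrite !inE; case: (boolP (i \in X)) => // /(subsetP sXU).
    by rewrite eqxx.
  rewrite mulr0; case: ifP => dXY; last by rewrite mul0r.
  case: eqP => [E|_]; last by rewrite mulr0.
  case/eqP: nY; rewrite E setDUl setDv set0U; apply/setDidPl.
  by rewrite disjoint_sym.
apply/ffunP => -[U V]; rewrite dmulE dform_scaleE dbaseE xpair_eqE /=.
transitivity ((\sum_(Z in powerset U) wsign R Z (U :\: Z) * ((Z == A)%:R * (U :\: Z == C)%:R)) *
  (\sum_(Z in powerset V) wsign R Z (V :\: Z) * ((Z == B)%:R * (V :\: Z == D)%:R))).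
  rewrite big_distrlr /=; apply: eq_bigr => X _; apply: eq_bigr => Y _.
  by rewrite !dbaseE !xpair_eqE -!mulnb !natrM; ring.
by rewrite !half -mulnb natrM; ring.
Qed.

Lemma dmulDl w t s : dmul (w + t) s = dmul w s + dmul t s.
Proof.
apply/ffunP => u; rewrite dform_addE !dmulE -big_split; apply: eq_bigr => X _ /=.
rewrite -big_split; apply: eq_bigr => Y _ /=.
by rewrite dform_addE; ring.
Qed.

Lemma dmulDr w t s : dmul s (w + t) = dmul s w + dmul s t.
Proof.
apply/ffunP => u; rewrite dform_addE !dmulE -big_split; apply: eq_bigr => X _ /=.
rewrite -big_split; apply: eq_bigr => Y _ /=.
by rewrite dform_addE; ring.
Qed.

Lemma dmulZl k w t : dmul (k *: w) t = k *: dmul w t.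
Proof.
apply/ffunP => u; rewrite dform_scaleE !dmulE mulr_sumr.
apply: eq_bigr => X _; rewrite mulr_sumr; apply: eq_bigr => Y _.
by rewrite dform_scaleE; ring.
Qed.

Lemma dmulZr k w t : dmul w (k *: t) = k *: dmul w t.
Proof.
apply/ffunP => u; rewrite dform_scaleE !dmulE mulr_sumr.
apply: eq_bigr => X _; rewrite mulr_sumr; apply: eq_bigr => Y _.
by rewrite dform_scaleE; ring.
Qed.

Lemma dmul_is_linear w : linear (dmul w).
Proof. by move=> k t s; rewrite dmulDr dmulZr. Qed.
HB.instance Definition _ w :=
  GRing.isLinear.Build R (dform R n) (dform R n) _ (dmul w) (dmul_is_linear w).

Lemma dmul0l t : dmul 0 t = 0 :> dform R n.
Proof. by have := dmulZl 0 0 t; rewrite !scale0r. Qed.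

Lemma dmulNl w t : dmul (- w) t = - dmul w t.
Proof. by rewrite -scaleN1r dmulZl scaleN1r. Qed.

Lemma dmulBl w t s : dmul (w - t) s = dmul w s - dmul t s.
Proof. by rewrite dmulDl dmulNl. Qed.

Lemma dmul_suml (T : Type) (r : seq T) (P : pred T) (F : T -> dform R n) t :
  dmul (\sum_(i <- r | P i) F i) t = \sum_(i <- r | P i) dmul (F i) t.
Proof.
exact: (big_morph (fun w => dmul w t) (fun x y => dmulDl x y t) (dmul0l t)).
Qed.

Lemma dmul0r w : dmul w 0 = 0 :> dform R n.
Proof. exact: linear0. Qed.

Lemma dmulNr w t : dmul w (- t) = - dmul w t.
Proof. exact: linearN. Qed.

Lemma dmulBr w t s : dmul s (w - t) = dmul s w - dmul s t.
Proof. exact: linearB. Qed.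

Lemma dmul_sumr (T : Type) (r : seq T) (P : pred T) (F : T -> dform R n) t :
  dmul t (\sum_(i <- r | P i) F i) = \sum_(i <- r | P i) dmul t (F i).
Proof. exact: linear_sum. Qed.

Lemma dmulA w t s : dmul w (dmul t s) = dmul (dmul w t) s.
Proof.
elim/dform_linear_ind: w => [w w' IH IH'|k w IH|A B]; first by rewrite !dmulDl IH IH'.
  by rewrite !dmulZl IH.
elim/dform_linear_ind: t => [w w' IH IH'|k w IH|C D].
- by rewrite !(dmulDl, dmulDr) IH IH'.
- by rewrite !(dmulZl, dmulZr) IH.
elim/dform_linear_ind: s => [w w' IH IH'|k w IH|I J].
- by rewrite !dmulDr IH IH'.
- by rewrite !dmulZr IH.
rewrite !(dmul_base, dmulZl, dmulZr) !scalerA !setUA; congr (_ *: _).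
transitivity ((eps C I * eps A (C :|: I)) * (eps D J * eps B (D :|: J))); first by ring.
by rewrite -!eps_cocycle; ring.
Qed.

Lemma dmul1l w : dmul (dunit R n) w = w.
Proof.
elim/dform_linear_ind: w => [w w' IH IH'|k w IH|A B].
- by rewrite linearD /= IH IH'.
- by rewrite linearZ /= IH.
by rewrite dmul_base !eps0l !set0U mulr1 scale1r.
Qed.

Lemma dmul1r w : dmul w (dunit R n) = w.
Proof.
elim/dform_linear_ind: w => [w w' IH IH'|k w IH|A B].
- by rewrite dmulDl IH IH'.
- by rewrite dmulZl IH.
by rewrite dmul_base !eps0r !setU0 mulr1 scale1r.
Qed.

End Product.

(** * Exterior products and contractions by basis vectors *)

Section Operators.
Variables (R : realType) (n : nat).
Implicit Types (w t s : dform R n) (A B C D I J : {set 'I_n}) (a b c i j : 'I_n).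

Local Notation dl a := (dbase R [set a] set0).
Local Notation dr a := (dbase R set0 [set a]).

(** The exchange of the two factors transports every statement about the first
    factor to the second one. *)
Definition dswap w : dform R n := [ffun u => w (u.2, u.1)].

Lemma dswapE w I J : dswap w (I, J) = w (J, I).
Proof. by rewrite ffunE. Qed.

Lemma dswap_is_linear : linear dswap.
Proof.
by move=> k w t; apply/ffunP => -[I J]; rewrite dform_addE dform_scaleE !dswapE dform_addE dform_scaleE.
Qed.
HB.instance Definition _ :=
  GRing.isLinear.Build R (dform R n) (dform R n) _ dswap dswap_is_linear.

Lemma dswapD w t : dswap (w + t) = dswap w + dswap t.
Proof. exact: linearD. Qed.

Lemma dswapZ (k : R) w : dswap (k *: w) = k *: dswap w.
Proof. exact: linearZ. Qed.

Lemma dswapK : involutive dswap.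
Proof. by move=> w; apply/ffunP => -[I J]; rewrite !dswapE. Qed.

Lemma dswap_base I J : dswap (dbase R I J) = dbase R J I.
Proof. by apply/ffunP => -[A B]; rewrite dswapE !dbaseE !xpair_eqE andbC. Qed.

Lemma dswap_unit : dswap (dunit R n) = dunit R n.
Proof. exact: dswap_base. Qed.

Lemma dswap_mul w t : dswap (dmul w t) = dmul (dswap w) (dswap t).
Proof.
elim/dform_linear_ind: w => [w w' IH IH'|k w IH|A B].
- by rewrite !(dmulDl, linearD) /= IH IH'.
- by rewrite !(dmulZl, linearZ) /= IH.
elim/dform_linear_ind: t => [w w' IH IH'|k w IH|C D].
- by rewrite !(dmulDr, linearD) /= IH IH'.
- by rewrite !(dmulZr, linearZ) /= IH.
by rewrite dmul_base linearZ /= !dswap_base dmul_base mulrC.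
Qed.

Lemma contrlE i w I J : contrl i w (I, J) =
  if i \in I then 0 else wsign R [set i] I * w (i |: I, J).
Proof. by rewrite ffunE. Qed.

Lemma contrrE i w I J : contrr i w (I, J) =
  if i \in J then 0 else wsign R [set i] J * w (I, i |: J).
Proof. by rewrite ffunE. Qed.

Lemma contrl_is_linear i : linear (contrl i : dform R n -> dform R n).
Proof.
move=> k w t; apply/ffunP => -[I J].
rewrite dform_addE dform_scaleE !contrlE dform_addE dform_scaleE.
by case: ifP => _; [rewrite mulr0 addr0 | ring].
Qed.
HB.instance Definition _ i :=
  GRing.isLinear.Build R (dform R n) (dform R n) _ (contrl i) (contrl_is_linear i).

Lemma contrlD i w t : contrl i (w + t) = contrl i w + contrl i t.
Proof. exact: linearD. Qed.

Lemma contrlZ i (k : R) w : contrl i (k *: w) = k *: contrl i w.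
Proof. exact: linearZ. Qed.

Lemma contrr_is_linear i : linear (contrr i : dform R n -> dform R n).
Proof.
move=> k w t; apply/ffunP => -[I J].
rewrite dform_addE dform_scaleE !contrrE dform_addE dform_scaleE.
by case: ifP => _; [rewrite mulr0 addr0 | ring].
Qed.
HB.instance Definition _ i :=
  GRing.isLinear.Build R (dform R n) (dform R n) _ (contrr i) (contrr_is_linear i).

Lemma dswap_contrl i w : dswap (contrl i w) = contrr i (dswap w).
Proof. by apply/ffunP => -[I J]; rewrite dswapE !ffunE. Qed.

Lemma dswap_contrr i w : dswap (contrr i w) = contrl i (dswap w).
Proof. by apply/ffunP => -[I J]; rewrite dswapE !ffunE. Qed.

Lemma dl_base a I J :
  dmul (dl a) (dbase R I J) = eps R [set a] I *: dbase R (a |: I) J.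
Proof. by rewrite dmul_base eps0l mulr1 set0U. Qed.

Lemma dr_base a I J :
  dmul (dr a) (dbase R I J) = eps R [set a] J *: dbase R I (a |: J).
Proof. by rewrite dmul_base eps0l mul1r set0U. Qed.

Lemma dlE a w I J : dmul (dl a) w (I, J) =
  if a \in I then wsign R [set a] (I :\ a) * w (I :\ a, J) else 0.
Proof.
elim/dform_linear_ind: w => [w w' IH IH'|k w IH|C D].
- rewrite dmulDr !dform_addE IH IH'; case: ifP => _; last by rewrite addr0.
  by rewrite mulrDr.
- rewrite dmulZr !dform_scaleE IH; case: ifP => _; last by rewrite mulr0.
  by rewrite mulrCA.
rewrite dl_base dform_scaleE !dbaseE !xpair_eqE /eps disjoints1.
have [aC|aC] /= := boolP (a \in C).
  rewrite mul0r; case: ifP => // aI; case: eqP => [E|]; last by rewrite mulr0.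
  by move: aC; rewrite -E !inE eqxx.
have [->|nI] := eqVneq I (a |: C); first by rewrite setU11 setU1K // eqxx.
rewrite mulr0; case: ifP => // aI; case: eqP => [E|]; last by rewrite mulr0.
by case/eqP: nI; rewrite -E setD1K.
Qed.

(** Double forms are generated by the unit under exterior product by the
    coordinate covectors in either factor: up to sign, dx^I is obtained from a
    smaller index set by one such product. *)
Lemma dform_ind (P : dform R n -> Prop) :
  (forall w t, P w -> P t -> P (w + t)) -> (forall k w, P w -> P (k *: w)) ->
  P (dunit R n) -> (forall a w, P w -> P (dmul (dl a) w)) ->
  (forall a w, P w -> P (dmul (dr a) w)) -> forall w, P w.
Proof.
move=> PD PZ P1 Pl Pr; apply: dform_linear_ind => // I J.
have [m] := ubnP (#|I| + #|J|); elim: m I J => // m IH I J.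
rewrite ltnS => le_m.
have [I0|[a aI]] := set_0Vmem I; last first.
  have {}IH : P (dbase R (I :\ a) J).
    by apply: IH; move: le_m; rewrite (cardsD1 a I) aI.
  have := PZ (eps R [set a] (I :\ a)) _ (Pl a _ IH).
  rewrite dl_base scalerA setD1K // /eps disjoints1 !inE eqxx /=.
  by rewrite wsign_sq scale1r.
rewrite {I}I0 in le_m *; have [->|[a aJ]] := set_0Vmem J; first exact: P1.
have {}IH : P (dbase R set0 (J :\ a)).
  by apply: IH; move: le_m; rewrite (cardsD1 a J) aJ addnS.
have := PZ (eps R [set a] (J :\ a)) _ (Pr a _ IH).
rewrite dr_base scalerA setD1K // /eps disjoints1 !inE eqxx /=.
by rewrite wsign_sq scale1r.
Qed.

Lemma eps11C a b : eps R [set a] [set b] = - eps R [set b] [set a].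
Proof. by rewrite eps1C cards1 mulN1r. Qed.

Lemma dl_dl a b w : dmul (dl a) (dmul (dl b) w) = - dmul (dl b) (dmul (dl a) w).
Proof.
rewrite !dmulA -dmulNl; congr (dmul _ w).
by rewrite !dl_base setUC eps11C scaleNr.
Qed.

Lemma dr_dr a b w : dmul (dr a) (dmul (dr b) w) = - dmul (dr b) (dmul (dr a) w).
Proof.
rewrite !dmulA -dmulNl; congr (dmul _ w).
by rewrite !dr_base setUC eps11C scaleNr.
Qed.

Lemma dl_dr a b w : dmul (dl a) (dmul (dr b) w) = dmul (dr b) (dmul (dl a) w).
Proof.
rewrite !dmulA; congr (dmul _ w).
by rewrite dl_base dr_base !setU0 !eps0r.
Qed.

Lemma wsign_swap i a : i != a ->
  wsign R [set i] [set a] = - wsign R [set a] [set i].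
Proof.
move=> ia; have := eps11C i a; rewrite /eps !disjoints1 !inE.
by rewrite (eq_sym a i) (negbTE ia).
Qed.

(** The canonical anticommutation relation.  For i <> a both composites move the
    same two indices, and they differ by the sign of dx^i /\ dx^a. *)
Lemma contrl_dl i a w :
  contrl i (dmul (dl a) w) = (i == a)%:R *: w - dmul (dl a) (contrl i w).
Proof.
apply/ffunP => -[I J]; rewrite dform_addE dform_scaleE [X in _ + X]ffunE.
rewrite contrlE !dlE contrlE; have [->|ia] := eqVneq i a.
  rewrite mul1r setU11; have [aI|aI] := boolP (a \in I).
    by rewrite !inE eqxx /= setD1K // mulrA wsign_sq mul1r subrr.
  by rewrite setU1K // mulrA wsign_sq mul1r subr0.
rewrite mul0r add0r !inE (eq_sym a i) (negbTE ia) /=.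
have [iI|iI] := boolP (i \in I).
  by rewrite mulr0 if_same oppr0.
have [aI|aI] := boolP (a \in I); last by rewrite mulr0 oppr0.
have -> : (i |: I) :\ a = i |: (I :\ a).
  by apply/setP => x; rewrite !inE; case: (eqVneq x i) => // ->; rewrite ia.
have -> : wsign R [set i] I = wsign R [set i] [set a] * wsign R [set i] (I :\ a).
  by rewrite -wsignUr ?setD1K // disjoints1 !inE eqxx.
have -> : wsign R [set a] (i |: I :\ a) =
    wsign R [set a] [set i] * wsign R [set a] (I :\ a).
  by rewrite wsignUr // disjoints1 !inE (negbTE iI) andbF.
rewrite (wsign_swap ia); have E := wsign_sq R [set a] [set i]; ring: E.
Qed.

Lemma dswap_dl a w : dswap (dmul (dl a) w) = dmul (dr a) (dswap w).
Proof. by rewrite dswap_mul dswap_base. Qed.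

Lemma dswap_dr a w : dswap (dmul (dr a) w) = dmul (dl a) (dswap w).
Proof. by rewrite dswap_mul dswap_base. Qed.

Lemma drE a w I J : dmul (dr a) w (I, J) =
  if a \in J then wsign R [set a] (J :\ a) * w (I, J :\ a) else 0.
Proof. by rewrite -[X in dmul _ X]dswapK -dswap_dl dswapE dlE dswapE. Qed.

Lemma contrl_dr i a w : contrl i (dmul (dr a) w) = dmul (dr a) (contrl i w).
Proof.
apply/ffunP => -[I J]; rewrite contrlE !drE contrlE.
by case: ifP => _; case: ifP => _; rewrite ?mulr0 // mulrCA.
Qed.

Lemma contrr_dr i a w :
  contrr i (dmul (dr a) w) = (i == a)%:R *: w - dmul (dr a) (contrr i w).
Proof.
apply: (can_inj dswapK); rewrite dswap_contrr dswap_dr contrl_dl.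
by rewrite linearB linearZ /= dswap_dr dswap_contrr.
Qed.

Lemma contrr_dl i a w : contrr i (dmul (dl a) w) = dmul (dl a) (contrr i w).
Proof.
apply: (can_inj dswapK).
by rewrite dswap_contrr !dswap_dl contrl_dr dswap_contrr.
Qed.

Lemma contrl_contrl i j w : contrl i (contrl j w) = - contrl j (contrl i w).
Proof.
apply/ffunP => -[I J]; rewrite [RHS]ffunE !contrlE !inE (eq_sym j i).
have [->|ij] := eqVneq i j; first by rewrite /= mulr0 if_same oppr0.
rewrite /=; have [iI|iI] := boolP (i \in I); first by rewrite mulr0 if_same oppr0.
have [jI|jI] := boolP (j \in I); first by rewrite mulr0 oppr0.
rewrite !wsignUr ?disjoints1 // (wsign_swap ij) setUCA; ring.
Qed.

Lemma contrl_contrr i j w : contrl i (contrr j w) = contrr j (contrl i w).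
Proof.
apply/ffunP => -[I J]; rewrite contrlE !contrrE contrlE.
by case: ifP => _; case: ifP => _; rewrite ?mulr0 // mulrCA.
Qed.

Lemma contrl_unit i : contrl i (dunit R n) = 0.
Proof.
apply/ffunP => -[I J]; rewrite contrlE [RHS]ffunE; case: ifP => // iI.
rewrite dbaseE xpair_eqE; case: eqP => [E|]; last by rewrite mulr0.
by have := setU11 i I; rewrite E inE.
Qed.

Lemma contrr_unit i : contrr i (dunit R n) = 0.
Proof. by rewrite -dswap_unit -dswap_contrl contrl_unit linear0. Qed.

End Operators.

(** * Linear substitutions *)

Section Substitution.
Variables (R : realType) (n : nat).
Implicit Types (w t : dform R n) (A B C D I J : {set 'I_n}) (a b c i j : 'I_n).
Implicit Types (u v : 'rV[R]_n) (P Q : 'M[R]_n).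

Local Notation dl a := (dbase R [set a] set0).
Local Notation dr a := (dbase R set0 [set a]).

Lemma covlE v w : dmul (covl v) w = \sum_a v 0 a *: dmul (dl a) w.
Proof. by rewrite dmul_suml; apply: eq_bigr => a _; rewrite dmulZl. Qed.

Lemma covrE v w : dmul (covr v) w = \sum_a v 0 a *: dmul (dr a) w.
Proof. by rewrite dmul_suml; apply: eq_bigr => a _; rewrite dmulZl. Qed.

Lemma dl_covl a v w :
  dmul (dl a) (dmul (covl v) w) = - dmul (covl v) (dmul (dl a) w).
Proof.
rewrite !covlE linear_sum /= -sumrN; apply: eq_bigr => b _.
by rewrite linearZ /= dl_dl scalerN.
Qed.

Lemma covl_covl u v w :
  dmul (covl u) (dmul (covl v) w) = - dmul (covl v) (dmul (covl u) w).
Proof.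
rewrite [LHS]covlE [dmul (covl u) w]covlE linear_sum /= -sumrN.
by apply: eq_bigr => a _; rewrite linearZ /= dl_covl scalerN.
Qed.

Lemma covl_covr u v w :
  dmul (covl u) (dmul (covr v) w) = dmul (covr v) (dmul (covl u) w).
Proof.
rewrite [LHS]covlE [dmul (covl u) w]covlE linear_sum /=.
apply: eq_bigr => a _; rewrite linearZ /= !covrE linear_sum /=; congr (_ *: _).
by apply: eq_bigr => b _; rewrite linearZ /= dl_dr.
Qed.

Lemma covl_sq u w : dmul (covl u) (dmul (covl u) w) = 0.
Proof. by apply: eq_opp0; exact: covl_covl. Qed.

Lemma dswap_covl v : dswap (covl v) = covr v.
Proof.
by rewrite linear_sum; apply: eq_bigr => a _; rewrite linearZ /= dswap_base.
Qed.

(** The image of dx^I under a substitution is a product in the order of [enum I];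
    the products below are along arbitrary sequences, so that factors can be
    moved around. *)
Definition wedge_l P (s : seq 'I_n) : dform R n :=
  foldr (fun a => dmul (covl (row a P))) (dunit R n) s.
Definition wedge_r P (s : seq 'I_n) : dform R n :=
  foldr (fun a => dmul (covr (row a P))) (dunit R n) s.

Lemma dswap_wedge_l P s : dswap (wedge_l P s) = wedge_r P s.
Proof.
elim: s => [|a s IH] /=; first exact: dswap_unit.
by rewrite dswap_mul dswap_covl IH.
Qed.

Lemma wedge_l_covr P s v w :
  dmul (wedge_l P s) (dmul (covr v) w) = dmul (covr v) (dmul (wedge_l P s) w).
Proof.
elim: s => [|a s IH] /=; first by rewrite !dmul1l.
by rewrite -!dmulA IH covl_covr.
Qed.

Lemma wedge_lr P s1 s2 :
  dmul (wedge_l P s1) (wedge_r P s2) = dmul (wedge_r P s2) (wedge_l P s1).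
Proof.
elim: s2 => [|a s IH] /=; first by rewrite dmul1l dmul1r.
by rewrite wedge_l_covr IH dmulA.
Qed.

Lemma wedge_l_mid P a s1 s2 : wedge_l P (s1 ++ a :: s2) =
  (-1) ^+ size s1 *: dmul (covl (row a P)) (wedge_l P (s1 ++ s2)).
Proof.
elim: s1 => [|b s1 IH] /=; first by rewrite scale1r.
by rewrite IH linearZ /= covl_covl exprS mulN1r scaleNr scalerN.
Qed.

Lemma sorted_enum_ord A : sorted (fun i j : 'I_n => (i < j)%N) (enum A).
Proof.
have: sorted (relpre (@nat_of_ord n) ltn) (enum 'I_n).
  by rewrite -sorted_map val_enum_ord iota_ltn_sorted.
rewrite enumT => srt; rewrite {1}/enum_mem; apply: sorted_filter => //.
by move=> ? ? ?; apply: ltn_trans.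
Qed.

(** Inserting a in the increasing enumeration of A: this is what relates the order
    of the factors of dx^(a u A) to the sign of dx^a /\ dx^A. *)
Lemma enum_split A a : a \notin A ->
  enum (a |: A) = [seq i : 'I_n <- enum A | (i < a)%N] ++ a :: [seq i : 'I_n <- enum A | (a < i)%N]
  /\ enum A = [seq i : 'I_n <- enum A | (i < a)%N] ++ [seq i : 'I_n <- enum A | (a < i)%N].
Proof.
move=> aA; pose lt := (fun i j : 'I_n => (i < j)%N).
have ltT : transitive lt by move=> ? ? ?; apply: ltn_trans.
have ltI : irreflexive lt by move=> ?; apply: ltnn.
have srt := sorted_enum_ord A.
have pw (Q : pred 'I_n) : pairwise lt [seq i : 'I_n <- enum A | Q i].
  by rewrite -sorted_pairwise // sorted_filter.
have mem_eA i : (i \in enum A) = (i \in A) by rewrite mem_enum.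
have srt1 : sorted lt (enum (a |: A)) by apply: sorted_enum_ord.
have mem_e1 i : (i \in enum (a |: A)) = (i == a) || (i \in A).
  by rewrite mem_enum !inE.
move: (enum A) (enum (a |: A)) srt pw mem_eA srt1 mem_e1 => e e1 srt pw mem_eA srt1 mem_e1.
split; apply: (irr_sorted_eq ltT ltI) => //.
- rewrite sorted_pairwise // pairwise_cat /= !pw !andbT.
  apply/andP; split.
    apply/allrelP => i j; rewrite mem_filter => /andP[ia _].
    rewrite inE => /predU1P[->//|]; rewrite mem_filter => /andP[aj _].
    exact: ltn_trans aj.
  by apply/allP => i; rewrite mem_filter => /andP[].
- move=> i; rewrite mem_cat in_cons !mem_filter mem_eA mem_e1.
  by rewrite -val_eqE /=; case: ltngtP => //=; rewrite ?orbF.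
- rewrite sorted_pairwise // pairwise_cat !pw !andbT.
  apply/allrelP => i j; rewrite !mem_filter => /andP[ia _] /andP[aj _].
  exact: ltn_trans aj.
- move=> i; rewrite mem_cat !mem_filter mem_eA.
  have [->|] := eqVneq i a; first by rewrite (negbTE aA) !andbF.
  by rewrite -val_eqE /=; case: ltngtP => //=; rewrite ?orbF.
Qed.

Lemma wsign1_count a A :
  wsign R [set a] A = (-1) ^+ size [seq i : 'I_n <- enum A | (i < a)%N].
Proof.
rewrite wsign_prod big_set1 -big_enum /=; elim: (enum A) => [|i s IH] /=.
  by rewrite big_nil.
by rewrite big_cons IH; case: ifP => _ /=; rewrite ?mul1r // -exprS.
Qed.

(** If a is in A, a factor is repeated and both sides vanish; otherwise moving a
    to its place crosses the elements of A that are smaller than a. *)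
Lemma wedge_l_setU P a A : eps R [set a] A *: wedge_l P (enum (a |: A)) =
  dmul (covl (row a P)) (wedge_l P (enum A)).
Proof.
rewrite /eps disjoints1; have [aA|aA] /= := boolP (a \in A); last first.
  have [-> E] := enum_split aA.
  by rewrite wedge_l_mid -E scalerA wsign1_count -expr2 sqrr_sign scale1r.
rewrite scale0r -(setD1K aA); have aD : a \notin A :\ a by rewrite !inE eqxx.
have [-> _] := enum_split aD.
by rewrite wedge_l_mid linearZ /= covl_sq scaler0.
Qed.

Lemma dsubst_is_linear P : linear (dsubst P : dform R n -> dform R n).
Proof.
move=> k w t; rewrite scaler_sumr -big_split; apply: eq_bigr => u _ /=.
by rewrite dform_addE dform_scaleE scalerDl scalerA.
Qed.
HB.instance Definition _ P :=
  GRing.isLinear.Build R (dform R n) (dform R n) _ (dsubst P) (dsubst_is_linear P).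

Lemma dsubst_base P I J :
  dsubst P (dbase R I J) = dmul (wedge_l P (enum I)) (wedge_r P (enum J)).
Proof.
rewrite /dsubst (bigD1 (I, J)) //= big1 ?addr0 => [|u uIJ].
  by rewrite dbaseE eqxx scale1r.
by rewrite dbaseE (negbTE uIJ) scale0r.
Qed.

Lemma dsubst_unit P : dsubst P (dunit R n) = dunit R n.
Proof. by rewrite dsubst_base enum_set0 dmul1l. Qed.

Lemma dswap_dsubst P w : dswap (dsubst P w) = dsubst P (dswap w).
Proof.
elim/dform_linear_ind: w => [w w' IH IH'|k w IH|A B].
- by rewrite !linearD /= IH IH'.
- by rewrite !linearZ /= IH.
rewrite dswap_base !dsubst_base dswap_mul -!dswap_wedge_l dswapK.
by rewrite !dswap_wedge_l wedge_lr.
Qed.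

(** A substitution is a morphism of algebras; it is enough to know this for the
    generators. *)
Lemma dsubst_dl P a w :
  dsubst P (dmul (dl a) w) = dmul (covl (row a P)) (dsubst P w).
Proof.
elim/dform_linear_ind: w => [w w' IH IH'|k w IH|A B].
- by rewrite !linearD /= IH IH'.
- by rewrite !linearZ /= IH.
by rewrite dl_base linearZ /= !dsubst_base dmulA -wedge_l_setU dmulZl.
Qed.

Lemma dsubst_dr P a w :
  dsubst P (dmul (dr a) w) = dmul (covr (row a P)) (dsubst P w).
Proof.
apply: (can_inj (@dswapK R n)).
by rewrite dswap_dsubst dswap_dr dsubst_dl dswap_mul -dswap_covl dswapK -dswap_dsubst.
Qed.

Lemma dsubstK P Q w : Q *m P = 1%:M -> dsubst P (dsubst Q w) = w.
Proof.
move=> QP; have dcov a : \sum_b Q a b *: covl (row b P) = dl a.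
  transitivity (\sum_c (Q *m P) a c *: dl c); last first.
    rewrite QP (bigD1 a) //= big1 ?addr0 => [|c ca].
      by rewrite mxE eqxx scale1r.
    by rewrite mxE eq_sym (negbTE ca) scale0r.
  under [RHS]eq_bigr => c _ do rewrite mxE scaler_suml.
  rewrite exchange_big; apply: eq_bigr => b _; rewrite scaler_sumr.
  by apply: eq_bigr => c _; rewrite scalerA mxE.
have dcovr a : \sum_b Q a b *: covr (row b P) = dr a.
  rewrite -dswap_base -dcov linear_sum; apply: eq_bigr => b _.
  by rewrite linearZ /= dswap_covl.
elim/dform_ind: w => [w w' IH IH'|k w IH||a w IH|a w IH].
- by rewrite !linearD /= IH IH'.
- by rewrite !linearZ /= IH.
- by rewrite !dsubst_unit.
- rewrite dsubst_dl covlE linear_sum /= -dcov dmul_suml; apply: eq_bigr => b _.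
  by rewrite linearZ /= dsubst_dl IH mxE dmulZl.
- rewrite dsubst_dr covrE linear_sum /= -dcovr dmul_suml; apply: eq_bigr => b _.
  by rewrite linearZ /= dsubst_dr IH mxE dmulZl.
Qed.

(** Contraction is natural: the vector is pushed forward by the substitution.  Both
    sides obey the same anticommutation relations with the generators. *)
Lemma contrl_dsubst P i w :
  contrl i (dsubst P w) = \sum_a P a i *: dsubst P (contrl a w).
Proof.
elim/dform_ind: w => [w w' IH IH'|k w IH||b w IH|b w IH].
- rewrite !linearD /= IH IH' -big_split; apply: eq_bigr => a _.
  by rewrite !linearD.
- rewrite !linearZ /= IH scaler_sumr; apply: eq_bigr => a _.
  by rewrite !linearZ /= scalerA mulrC -scalerA.
- rewrite dsubst_unit contrl_unit big1 // => a _.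
  by rewrite contrl_unit linear0 scaler0.
- rewrite dsubst_dl covlE linear_sum /=.
  under [RHS]eq_bigr => a _ do rewrite contrl_dl linearB linearZ /= dsubst_dl scalerBr.
  rewrite sumrB [X in _ = X - _](bigD1 b) //= eqxx scale1r [X in _ = _ + X - _]big1 ?addr0; last first.
    by move=> a /negbTE->; rewrite scale0r scaler0.
  under eq_bigr => a _ do rewrite linearZ /= contrl_dl scalerBr mxE.
  rewrite sumrB (bigD1 i) //= eqxx scale1r [X in _ + X - _]big1 ?addr0; last first.
    by move=> a ai; rewrite eq_sym (negbTE ai) scale0r scaler0.
  congr (_ - _).
  transitivity (dmul (covl (row b P)) (contrl i (dsubst P w))).
    by rewrite covlE; apply: eq_bigr => a _; rewrite mxE.
  by rewrite IH linear_sum /=; apply: eq_bigr => a _; rewrite linearZ.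
- rewrite dsubst_dr covrE linear_sum /=.
  under [RHS]eq_bigr => a _ do rewrite contrl_dr dsubst_dr.
  under eq_bigr => a _ do rewrite linearZ /= contrl_dr.
  rewrite -covrE IH linear_sum /=; apply: eq_bigr => a _.
  by rewrite linearZ.
Qed.

End Substitution.

(** * Existence of orthonormal bases *)

Section OrthonormalBasis.
Variable R : realType.

Definition posdef n (G : 'M[R]_n) :=
  G^T = G /\ forall v : 'rV[R]_n, v != 0 -> 0 < (v *m G *m v^T) 0 0.

(** By induction on the dimension, as for the Cholesky decomposition. *)
Lemma onb_exists n (G : 'M[R]_n) : posdef G ->
  exists E : 'M[R]_n, E^T *m G *m E = 1%:M.
Proof.
elim: n G => [|n IH] G [Gsym Gpos].
  by exists 1%:M; apply/matrixP => -[].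
rewrite -[n.+1]/(1 + n)%N in G Gsym Gpos *.
pose a := ulsubmx G 0 0; pose x := ursubmx G; pose B := drsubmx G.
have GE : G = block_mx a%:M x x^T B.
  rewrite -{1}[G]submxK; congr block_mx; first exact: mx11_scalar.
  by rewrite /x -{2}Gsym trmx_ursub trmxK.
have Bsym : B^T = B by rewrite /B trmx_drsub Gsym.
have a_gt0 : 0 < a.
  have := Gpos (row_mx 1%:M 0); rewrite GE mul_row_block tr_row_mx mul_row_col.
  rewrite !mul1mx !mul0mx !addr0 trmx0 mulmx0 addr0 trmx1 mulmx1 mxE eqxx mulr1n.
  apply; apply/eqP => /(congr1 lsubmx); rewrite row_mxKl linear0.
  by move=> /matrixP/(_ 0 0); rewrite !mxE => /eqP; rewrite oner_eq0.
have a_neq0 : a != 0 by rewrite gt_eqF.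
(* F completes the square; S is the Schur complement of the entry a. *)
pose F := block_mx 1%:M (- a^-1 *: x) 0 1%:M : 'M[R]_(1 + n).
pose S := B - a^-1 *: (x^T *m x).
have FGF : F^T *m G *m F = block_mx a%:M 0 0 S.
  rewrite GE tr_block_mx !trmx1 !trmx0 !mulmx_block !mul1mx !mul0mx !mulmx0.
  rewrite !mulmx1 !addr0 !linearZ /= -!scalemxAl mul_mx_scalar mul_scalar_mx !scalerA.
  rewrite mulNr mulVf // !scaleN1r !addNr mul0mx scaler0 add0r.
  by rewrite addrC scaleNr.
have [|E E_onb] := IH S.
  split=> [|v v0]; first by rewrite /S !linearB /= linearZ /= trmx_mul trmxK Bsym.
  have := Gpos (row_mx 0 v *m F^T); rewrite trmx_mul trmxK.
  have -> : row_mx 0 v *m F^T *m G *m (F *m (row_mx 0 v)^T) =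
      row_mx 0 v *m (F^T *m G *m F) *m (row_mx 0 v)^T by rewrite !mulmxA.
  rewrite FGF mul_row_block tr_row_mx mul_row_col !mul0mx !mulmx0 !add0r trmx0.
  rewrite mulmx0 add0r; apply; apply/eqP => /(congr1 rsubmx).
  rewrite tr_block_mx mul_row_block !trmx0 !trmx1 row_mxKr mulmx0 mulmx1 add0r.
  by rewrite linear0; apply/eqP.
pose D := block_mx (Num.sqrt a)^-1%:M 0 0 E : 'M[R]_(1 + n).
exists (F *m D); rewrite trmx_mul.
have -> : D^T *m F^T *m G *m (F *m D) = D^T *m (F^T *m G *m F) *m D.
  by rewrite !mulmxA.
rewrite FGF tr_block_mx !mulmx_block !trmx0 !(mul0mx, mulmx0, addr0, add0r).
rewrite E_onb tr_scalar_mx -!scalar_mxM [RHS]scalar_mx_block; congr block_mx.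
congr (_ %:M); rewrite -{2}(sqr_sqrtr (ltW a_gt0)) expr2 mulrA mulVf ?mul1r ?divff //.
  by rewrite gt_eqF // sqrtr_gt0.
by rewrite gt_eqF // sqrtr_gt0.
Qed.

End OrthonormalBasis.

(** * Bidegrees *)

Section Homogeneous.
Variables (R : realType) (n : nat).
Implicit Types (w t s : dform R n) (A B C D I J : {set 'I_n}) (a b c i j : 'I_n).

Local Notation dl a := (dbase R [set a] set0).
Local Notation dr a := (dbase R set0 [set a]).

Definition bidegree (p q : nat) w : Prop :=
  forall I J, (#|I|, #|J|) != (p, q) -> w (I, J) = 0.

Lemma bidegree0 p q : bidegree p q 0.
Proof. by move=> I J _; rewrite ffunE. Qed.

Lemma bidegreeD p q w t : bidegree p q w -> bidegree p q t -> bidegree p q (w + t).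
Proof. by move=> hw ht I J IJ; rewrite dform_addE hw // ht // addr0. Qed.

Lemma bidegreeZ p q k w : bidegree p q w -> bidegree p q (k *: w).
Proof. by move=> hw I J IJ; rewrite dform_scaleE hw // mulr0. Qed.

Lemma bidegreeN p q w : bidegree p q w -> bidegree p q (- w).
Proof. by rewrite -scaleN1r; apply: bidegreeZ. Qed.

Lemma bidegree_sum (T : Type) (r : seq T) (P : pred T) (F : T -> dform R n) p q :
  (forall x, P x -> bidegree p q (F x)) -> bidegree p q (\sum_(i <- r | P i) F i).
Proof.
by move=> hF; apply: big_ind => //; [apply: bidegree0 | move=> ? ?; apply: bidegreeD].
Qed.

Lemma bidegree_base I J : bidegree #|I| #|J| (dbase R I J).
Proof.
move=> A B nAB; rewrite dbaseE; case: eqP => // -[E1 E2].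
by rewrite E1 E2 eqxx in nAB.
Qed.

Lemma bidegree_mul p q p' q' w t : bidegree p q w -> bidegree p' q' t ->
  bidegree (p + p')%N (q + q')%N (dmul w t).
Proof.
move=> hw ht I J IJ; rewrite dmulE big1 // => A; rewrite powersetE => sA.
rewrite big1 // => B; rewrite powersetE => sB.
have [[Ap Bq]|nAB] := eqVneq (#|A|, #|B|) (p, q); last first.
  by rewrite hw // mulr0 mul0r.
rewrite ht ?mulr0 //; apply: contraNneq IJ => -[IA JB].
rewrite -Ap -Bq -IA -JB !cardsDS // !subnKC //; exact: subset_leq_card.
Qed.

Lemma bidegree_dl a p q w : bidegree p q w -> bidegree p.+1 q (dmul (dl a) w).
Proof.
have h : bidegree 1 0 (dl a) by have := @bidegree_base [set a] set0; rewrite cards1 cards0.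
by move=> hw; have := bidegree_mul h hw.
Qed.

Lemma bidegree_dr a p q w : bidegree p q w -> bidegree p q.+1 (dmul (dr a) w).
Proof.
have h : bidegree 0 1 (dr a) by have := @bidegree_base set0 [set a]; rewrite cards1 cards0.
by move=> hw; have := bidegree_mul h hw.
Qed.

Lemma bidegree_contrl a p q w : bidegree p.+1 q w -> bidegree p q (contrl a w).
Proof.
move=> hw I J IJ; rewrite contrlE; case: ifP => // aI; rewrite hw ?mulr0 //.
by apply: contraNneq IJ => -[]; rewrite cardsU1 aI add1n => -[-> ->].
Qed.

Lemma bidegree_contrr a p q w : bidegree p q.+1 w -> bidegree p q (contrr a w).
Proof.
move=> hw I J IJ; rewrite contrrE; case: ifP => // aI; rewrite hw ?mulr0 //.
by apply: contraNneq IJ => -[]; rewrite cardsU1 aI add1n => -> [->].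
Qed.

Lemma contrl_bidegree0 a q w : bidegree 0 q w -> contrl a w = 0.
Proof.
move=> hw; apply/ffunP => -[I J]; rewrite contrlE [RHS]ffunE; case: ifP => // aI.
by rewrite hw ?mulr0 // cardsU1 aI.
Qed.

Lemma contrr_bidegree0 a p w : bidegree p 0 w -> contrr a w = 0.
Proof.
move=> hw; apply/ffunP => -[I J]; rewrite contrrE [RHS]ffunE; case: ifP => // aI.
by rewrite hw ?mulr0 // cardsU1 aI xpair_eqE andbF.
Qed.

Lemma bidegree_unit : bidegree 0 0 (dunit R n).
Proof. by have := @bidegree_base set0 set0; rewrite cards0. Qed.

Lemma bidegree_pow p q k w : bidegree p q w -> bidegree (k * p)%N (k * q)%N (dpow w k).
Proof.
move=> hw; elim: k => [|k IH]; first exact: bidegree_unit.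
by rewrite /dpow iterS !mulSn; apply: bidegree_mul.
Qed.

(** Bigraded commutativity, in the case of a covector of the first factor. *)
Lemma dl_comm a p q w : bidegree p q w ->
  dmul w (dl a) = (-1) ^+ p *: dmul (dl a) w.
Proof.
move=> hw; rewrite {1 2}(dform_expand w) dmul_suml linear_sum scaler_sumr.
apply: eq_bigr => -[I J] _ /=; rewrite dmulZl linearZ /= dl_base scalerA.
have [[Ip _]|nIJ] := eqVneq (#|I|, #|J|) (p, q); last by rewrite hw // mulr0 !scale0r.
rewrite dmul_base eps0r mulr1 setU0 eps1C Ip !scalerA setUC.
have E : (-1) ^+ p * (-1) ^+ p = 1 :> R by rewrite -expr2 sqrr_sign.
by congr (_ *: _); ring: E.
Qed.

(** This is the operator that counts indices in the first factor. *)
Lemma dl_contrl_sum p q w : bidegree p q w ->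
  \sum_a dmul (dl a) (contrl a w) = p%:R *: w.
Proof.
move=> hw; apply/ffunP => -[I J]; rewrite dform_sumE dform_scaleE.
have [[Ip _]|nIJ] := eqVneq (#|I|, #|J|) (p, q); last first.
  rewrite hw // mulr0 big1 // => a _; rewrite dlE; case: ifP => // aI.
  by rewrite contrlE !inE eqxx /= setD1K // hw // !mulr0.
rewrite -Ip -sum1_card natr_sum mulr_suml [RHS]big_mkcond; apply: eq_bigr => a _.
rewrite dlE; case: ifP => // aI.
by rewrite contrlE !inE eqxx /= setD1K // mulrA wsign_sq.
Qed.

Lemma bidegree_swap p q w : bidegree p q w -> bidegree q p (dswap w).
Proof.
move=> hw I J IJ; rewrite dswapE hw //.
by apply: contraNneq IJ => -[-> ->].
Qed.

Lemma dr_contrr_sum p q w : bidegree p q w ->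
  \sum_a dmul (dr a) (contrr a w) = q%:R *: w.
Proof.
move=> /bidegree_swap hw; apply: (can_inj (@dswapK R n)).
rewrite linearZ /= -(dl_contrl_sum hw) linear_sum /=.
by apply: eq_bigr => a _; rewrite dswap_dr dswap_contrr.
Qed.

End Homogeneous.

(** * Euclidean double forms *)

Section Euclidean.
Variables (R : realType) (n : nat) (G : 'M[R]_n).
Hypothesis G_pos : posdef G.
Implicit Types (w t s : dform R n) (A B C D I J : {set 'I_n}) (a b c i j : 'I_n).

Local Notation dl a := (dbase R [set a] set0).
Local Notation dr a := (dbase R set0 [set a]).
Local Notation E := (onb G).
Local Notation H := (invmx G).

Lemma onbP : E^T *m G *m E = 1%:M.
Proof.
apply: (@xgetPex _ 1%:M [set x | x^T *m G *m x = 1%:M]%classic).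
exact: onb_exists.
Qed.

Lemma onb_unit : E \in unitmx.
Proof. by have /mulmx1_unit[] := onbP. Qed.

Lemma onb_inv_metric : E *m E^T *m G = 1%:M.
Proof. by have /mulmx1C := onbP; rewrite mulmxA. Qed.

Lemma metric_unit : G \in unitmx.
Proof. by have /mulmx1_unit[] := onb_inv_metric. Qed.

Lemma onb_metric_inv : E *m E^T = H.
Proof. by rewrite -[RHS]mul1mx -onb_inv_metric mulmxK // metric_unit. Qed.

Lemma inv_metric_sym : H^T = H.
Proof. by rewrite -onb_metric_inv trmx_mul trmxK. Qed.

Lemma metricC a b : G a b = G b a.
Proof. by have [/matrixP/(_ b a)] := G_pos; rewrite mxE. Qed.

Lemma inv_metricC a b : H a b = H b a.
Proof. by have /matrixP/(_ b a) := inv_metric_sym; rewrite mxE. Qed.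

Lemma inv_metricK a b : \sum_c H a c * G c b = (a == b)%:R.
Proof.
by have /matrixP/(_ a b) := mulVmx metric_unit; rewrite !mxE.
Qed.

Lemma metricK a b : \sum_c G a c * H c b = (a == b)%:R.
Proof.
by have /matrixP/(_ a b) := mulmxV metric_unit; rewrite !mxE.
Qed.

Lemma innerC w t : inner G w t = inner G t w.
Proof. by apply: eq_bigr => A _; apply: eq_bigr => B _; rewrite mulrC. Qed.

Lemma innerDl w t s : inner G (w + t) s = inner G w s + inner G t s.
Proof.
rewrite -big_split; apply: eq_bigr => A _; rewrite -big_split.
by apply: eq_bigr => B _; rewrite /onb_coord linearD dform_addE mulrDl.
Qed.

Lemma innerZl k w t : inner G (k *: w) t = k * inner G w t.
Proof.
rewrite mulr_sumr; apply: eq_bigr => A _; rewrite mulr_sumr.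
by apply: eq_bigr => B _; rewrite /onb_coord linearZ /= dform_scaleE mulrA.
Qed.

Lemma inner0l t : inner G 0 t = 0.
Proof. by rewrite -(scale0r 0) innerZl mul0r. Qed.

Lemma innerNl w t : inner G (- w) t = - inner G w t.
Proof. by rewrite -scaleN1r innerZl mulN1r. Qed.

Lemma inner_suml (T : Type) (r : seq T) (P : pred T) (F : T -> dform R n) t :
  inner G (\sum_(x <- r | P x) F x) t = \sum_(x <- r | P x) inner G (F x) t.
Proof.
exact: (big_morph (fun w => inner G w t) (fun x y => innerDl x y t) (inner0l t)).
Qed.

Lemma innerDr w t s : inner G s (w + t) = inner G s w + inner G s t.
Proof. by rewrite innerC innerDl !(innerC s). Qed.

Lemma innerZr k w t : inner G t (k *: w) = k * inner G t w.
Proof. by rewrite innerC innerZl innerC. Qed.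

Lemma innerNr w t : inner G t (- w) = - inner G t w.
Proof. by rewrite innerC innerNl innerC. Qed.

Lemma inner_sumr (T : Type) (r : seq T) (P : pred T) (F : T -> dform R n) t :
  inner G t (\sum_(x <- r | P x) F x) = \sum_(x <- r | P x) inner G t (F x).
Proof.
by rewrite innerC inner_suml; apply: eq_bigr => x _; rewrite innerC.
Qed.

Lemma dsubst_onb_inj w : dsubst E w = 0 -> w = 0.
Proof.
move=> Ew; rewrite -(dsubstK (P := invmx E) (Q := E) w) ?mulmxV ?onb_unit //.
by rewrite Ew linear0.
Qed.

Lemma inner_ge0 w : 0 <= inner G w w.
Proof. by apply: sumr_ge0 => A _; apply: sumr_ge0 => B _; rewrite -expr2 sqr_ge0. Qed.

Lemma inner_eq0 w : inner G w w = 0 -> w = 0.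
Proof.
move=> /eqP; rewrite /inner pair_big psumr_eq0 => [/allP w0|u _]; last first.
  by rewrite -expr2 sqr_ge0.
apply: dsubst_onb_inj; apply/ffunP => u; rewrite [RHS]ffunE.
by have := w0 u (mem_index_enum _); rewrite /= mulf_eq0 orbb /onb_coord -surjective_pairing => /eqP.
Qed.

Lemma inner_inj w t : (forall s, inner G w s = inner G t s) -> w = t.
Proof.
move=> wt; apply/eqP; rewrite -subr_eq0; apply/eqP/inner_eq0.
by rewrite innerDl innerNl wt subrr.
Qed.

(** In coordinates on an orthonormal basis, contraction is the transpose of
    exterior product: both match I without a to I with a, with the same sign. *)
Lemma transpose_dl a w t :
  \sum_A \sum_B dmul (dl a) w (A, B) * t (A, B) =
  \sum_A \sum_B w (A, B) * contrl a t (A, B).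
Proof.
rewrite (bigID (fun A => a \in A)) /= [X in _ + X]big1 ?addr0; last first.
  by move=> A aA; rewrite big1 // => B _; rewrite dlE (negbTE aA) mul0r.
rewrite [RHS](bigID (fun A => a \in A)) /= [X in X + _]big1 ?add0r; last first.
  by move=> A aA; rewrite big1 // => B _; rewrite contrlE aA mulr0.
rewrite (reindex_onto (fun A => a |: A) (fun A => A :\ a)) /=; last first.
  by move=> A aA; rewrite setD1K.
apply: eq_big => [A|A].
  rewrite setU11 /=; apply/eqP/idP => [<-|aA]; first by rewrite !inE eqxx.
  by rewrite setU1K.
move=> /andP[_ /eqP EA]; have aA : a \notin A by rewrite -EA !inE eqxx.
by apply: eq_bigr => B _; rewrite dlE setU11 EA contrlE (negbTE aA); ring.
Qed.

(** The adjoint of exterior product by dx^a is contraction by the vector metrically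
    dual to dx^a.  The orthonormal basis disappears through E E^T = G^-1, so that this
    formula can be differentiated in G. *)
Lemma inner_dl a w t :
  inner G (dmul (dl a) w) t = \sum_b H a b * inner G w (contrl b t).
Proof.
rewrite /inner /onb_coord dsubst_dl covlE.
transitivity (\sum_i E a i * \sum_A \sum_B
    dmul (dl i) (dsubst E w) (A, B) * dsubst E t (A, B)).
  under [RHS]eq_bigr do rewrite mulr_sumr.
  rewrite [RHS]exchange_big /=; apply: eq_bigr => A _.
  under [RHS]eq_bigr do rewrite mulr_sumr.
  rewrite [RHS]exchange_big /=; apply: eq_bigr => B _ /=.
  rewrite dform_sumE mulr_suml; apply: eq_bigr => i _.
  by rewrite dform_scaleE mxE mulrA.
under eq_bigr => i _ do rewrite transpose_dl contrl_dsubst.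
transitivity (\sum_i \sum_b E a i * E b i * inner G w (contrl b t)).
  apply: eq_bigr => i _; rewrite /inner /onb_coord.
  under [RHS]eq_bigr do rewrite -mulrA; rewrite -mulr_sumr; congr (_ * _).
  under [RHS]eq_bigr do rewrite mulr_sumr.
  rewrite [RHS]exchange_big /=; apply: eq_bigr => A _ /=.
  under [RHS]eq_bigr do rewrite mulr_sumr.
  rewrite [RHS]exchange_big /=; apply: eq_bigr => B _ /=.
  rewrite [X in _ * X]dform_sumE mulr_sumr; apply: eq_bigr => b _.
  by rewrite dform_scaleE; ring.
rewrite exchange_big /=; apply: eq_bigr => b _; rewrite -mulr_suml.
by rewrite -onb_metric_inv mxE; congr (_ * _); apply: eq_bigr => i _; rewrite mxE.
Qed.

Lemma inner_swap w t : inner G (dswap w) (dswap t) = inner G w t.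
Proof.
rewrite /inner exchange_big /=; apply: eq_bigr => A _; apply: eq_bigr => B _.
by rewrite /onb_coord -!dswap_dsubst !dswapE.
Qed.

Lemma inner_swapl w t : inner G (dswap w) t = inner G w (dswap t).
Proof. by rewrite -[X in inner _ _ X](dswapK t) inner_swap. Qed.

Lemma inner_dr a w t :
  inner G (dmul (dr a) w) t = \sum_b H a b * inner G w (contrr b t).
Proof.
rewrite -inner_swap dswap_dr inner_dl; apply: eq_bigr => b _.
by rewrite -dswap_contrr inner_swap.
Qed.

Lemma inner_unit t : inner G (dunit R n) t = t (set0, set0).
Proof.
have Et : dsubst E t (set0, set0) = t (set0, set0).
  elim/dform_ind: t => [w w' IH IH'|k w IH||a w IH|a w IH].
  - by rewrite linearD !dform_addE IH IH'.
  - by rewrite linearZ /= !dform_scaleE IH.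
  - by rewrite dsubst_unit.
  - rewrite dsubst_dl covlE dform_sumE dlE inE big1 // => b _.
    by rewrite dform_scaleE dlE inE mulr0.
  - rewrite dsubst_dr covrE dform_sumE drE inE big1 // => b _.
    by rewrite dform_scaleE drE inE mulr0.
rewrite /inner pair_big (bigD1 (set0, set0)) //= big1 ?addr0 => [|u u0].
  by rewrite /onb_coord dsubst_unit Et dbaseE eqxx mul1r.
by rewrite /onb_coord dsubst_unit dbaseE -surjective_pairing (negbTE u0) mul0r.
Qed.

Lemma onb_expand w : w = \sum_A \sum_B onb_coord G w A B *: onb_form G A B.
Proof.
transitivity (dsubst (invmx E) (\sum_u dsubst E w u *: dbase R u.1 u.2)).
  by rewrite -dform_expand dsubstK // mulmxV // onb_unit.
by rewrite linear_sum [RHS]pair_big; apply: eq_bigr => -[A B] _; rewrite /= linearZ.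
Qed.

Lemma onb_coord_form I J A B :
  onb_coord G (onb_form G I J) A B = ((A, B) == (I, J))%:R.
Proof. by rewrite /onb_coord dsubstK ?dbaseE // mulVmx // onb_unit. Qed.

(** The [onb_form] are the basis dual to the coordinates [onb_coord], which makes
    the defining expansion of [iota_form] an expansion in an orthonormal basis. *)
Lemma iota_adjoint w t s : inner G (iota_form G t w) s = inner G w (dmul t s).
Proof.
rewrite /iota_form inner_suml [in RHS](onb_expand s) linear_sum /= inner_sumr.
apply: eq_bigr => I _; rewrite inner_suml linear_sum /= inner_sumr.
apply: eq_bigr => J _; rewrite linearZ /= innerZl innerZr mulrC; congr (_ * _).
rewrite /inner pair_big (bigD1 (I, J)) //= big1 ?addr0 => [|u uIJ].
  by rewrite onb_coord_form eqxx mul1r.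
by rewrite onb_coord_form -surjective_pairing (negbTE uIJ) mul0r.
Qed.

Lemma iota_covl (v : 'rV[R]_n) w :
  iota_form G (covl v) w = \sum_a v 0 a *: \sum_b H a b *: contrl b w.
Proof.
apply: inner_inj => s; rewrite iota_adjoint covlE inner_sumr inner_suml.
apply: eq_bigr => a _; rewrite innerZr innerZl innerC inner_dl inner_suml.
by congr (_ * _); apply: eq_bigr => b _; rewrite innerZl innerC.
Qed.

(** This characterises the star operator, as the scalar product is nondegenerate. *)
Lemma inner_star w t :
  inner G (dstar G w) t = n`!%:R^-1 * inner G (dpow (metric_form G) n) (dmul w t).
Proof. by rewrite innerZl iota_adjoint. Qed.

Local Notation g := (metric_form G).

Lemma metric_mul w : dmul g w = \sum_i \sum_j G i j *: dmul (dl i) (dmul (dr j) w).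
Proof.
rewrite dmul_suml; apply: eq_bigr => i _; rewrite dmul_suml.
apply: eq_bigr => j _; rewrite dmulZl dmulA; congr (_ *: dmul _ w).
by rewrite dl_base eps0r scale1r setU0.
Qed.

Lemma dswap_metric : dswap g = g.
Proof.
rewrite linear_sum [RHS]exchange_big /=; apply: eq_bigr => i _; rewrite linear_sum.
by apply: eq_bigr => j _; rewrite linearZ /= dswap_base metricC.
Qed.

Lemma dswap_metric_pow m : dswap (dpow g m) = dpow g m.
Proof.
elim: m => [|m IH]; first exact: dswap_unit.
by rewrite /dpow iterS dswap_mul dswap_metric; congr (dmul _ _).
Qed.

Lemma bidegree_metric : bidegree 1 1 g.
Proof.
apply: bidegree_sum => i _; apply: bidegree_sum => j _; apply: bidegreeZ.
by have := @bidegree_base R n [set i] [set j]; rewrite !cards1.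
Qed.

(** Contraction is an antiderivation, and contracting g by d/dx^a in the first
    factor leaves the covector metrically dual to d/dx^a in the second one. *)
Lemma contrl_metric a w :
  contrl a (dmul g w) = \sum_j G a j *: dmul (dr j) w - dmul g (contrl a w).
Proof.
rewrite !metric_mul linear_sum /= -[X in X - _](@sum_delta _ _ _ a (fun i => \sum_j G i j *: dmul (dr j) w)).
rewrite -sumrB; apply: eq_bigr => i _; rewrite linear_sum scaler_sumr -sumrB.
apply: eq_bigr => j _; rewrite /= linearZ /= contrl_dl contrl_dr scalerBr scalerA.
by rewrite scalerA mulrC.
Qed.

Lemma contrr_metric b w :
  contrr b (dmul g w) = \sum_i G i b *: dmul (dl i) w - dmul g (contrr b w).
Proof.
apply: (can_inj (@dswapK R n)).
rewrite linearB /= dswap_contrr !dswap_mul dswap_metric contrl_metric dswap_contrr.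
congr (_ - _); rewrite linear_sum; apply: eq_bigr => i _.
by rewrite linearZ /= dswap_dl metricC.
Qed.

(** The trace of the two factors, which is the adjoint of multiplication by g. *)
Definition contraction w : dform R n :=
  \sum_a \sum_b H a b *: contrr b (contrl a w).

Lemma inner_metric w t : inner G (dmul g w) t = inner G w (contraction t).
Proof.
rewrite metric_mul inner_suml.
under eq_bigr => i _.
  rewrite inner_suml.
  under eq_bigr => j _ do rewrite innerZl inner_dl mulr_sumr.
  rewrite exchange_big /=.
  over.
rewrite exchange_big /contraction inner_sumr; apply: eq_bigr => a _ /=.
rewrite inner_sumr exchange_big /=.
transitivity (\sum_j (a == j)%:R *: (inner G (dmul (dr j) w) (contrl a t) : R^o)).
  apply: eq_bigr => j _; rewrite -[_ *: _]/(_ * _) -inv_metricK mulr_suml.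
  apply: eq_bigr => i _; rewrite [H a i]inv_metricC; ring.
rewrite sum_delta inner_dr; apply: eq_bigr => b _.
by rewrite innerZr.
Qed.

(** Multiplication by g and the contraction generate an action of sl_2, on which
    bidegree (p, q) has weight p + q - n. *)
Lemma contraction_metric p q w : bidegree p q w ->
  contraction (dmul g w) = dmul g (contraction w) + (n%:R - p%:R - q%:R) *: w.
Proof.
move=> hw; rewrite /contraction.
transitivity (\sum_a \sum_b H a b *:
  ((G a b *: w - \sum_j G a j *: dmul (dr j) (contrr b w))
   - (\sum_i G i b *: dmul (dl i) (contrl a w) - dmul g (contrr b (contrl a w))))).
  apply: eq_bigr => a _; apply: eq_bigr => b _; congr (_ *: _).
  rewrite contrl_metric linearB /= contrr_metric; congr (_ - _).
  rewrite linear_sum -(@sum_delta _ _ _ b (fun j => G a j *: w)) -sumrB.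
  apply: eq_bigr => j _.
  by rewrite /= linearZ /= contrr_dr scalerBr !scalerA mulrC.
transitivity (\sum_a \sum_b (H a b * G a b) *: w
  - (\sum_a \sum_b H a b *: \sum_j G a j *: dmul (dr j) (contrr b w))
  - (\sum_a \sum_b H a b *: \sum_i G i b *: dmul (dl i) (contrl a w))
  + \sum_a \sum_b H a b *: dmul g (contrr b (contrl a w))).
  rewrite -!sumrB -big_split; apply: eq_bigr => a _ /=.
  rewrite -!sumrB -big_split; apply: eq_bigr => b _ /=.
  by rewrite !scalerBr opprB scalerA addrCA [LHS]addrC.
have -> : \sum_a \sum_b (H a b * G a b) *: w = n%:R *: w.
  transitivity (\sum_(a < n) w); last by rewrite sumr_const card_ord scaler_nat.
  apply: eq_bigr => a _; rewrite -scaler_suml.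
  by under eq_bigr do rewrite metricC; rewrite inv_metricK eqxx scale1r.
have -> : \sum_a \sum_b H a b *: (\sum_j G a j *: dmul (dr j) (contrr b w)) = q%:R *: w.
  rewrite -(dr_contrr_sum hw) exchange_big /=; apply: eq_bigr => b _.
  under eq_bigr do rewrite scaler_sumr; rewrite exchange_big /=.
  rewrite -[RHS](@sum_delta _ _ _ b (fun j => dmul (dr j) (contrr b w))).
  apply: eq_bigr => j _; rewrite -inv_metricK scaler_suml; apply: eq_bigr => a _.
  by rewrite scalerA inv_metricC.
have -> : \sum_a \sum_b H a b *: (\sum_i G i b *: dmul (dl i) (contrl a w)) = p%:R *: w.
  rewrite -(dl_contrl_sum hw); apply: eq_bigr => a _.
  under eq_bigr do rewrite scaler_sumr; rewrite exchange_big /=.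
  rewrite -[RHS](@sum_delta _ _ _ a (fun i => dmul (dl i) (contrl a w))).
  apply: eq_bigr => i _; rewrite -inv_metricK scaler_suml; apply: eq_bigr => b _.
  by rewrite scalerA [G b i]metricC.
have -> : dmul g (\sum_a \sum_b H a b *: contrr b (contrl a w)) =
    \sum_a \sum_b H a b *: dmul g (contrr b (contrl a w)).
  rewrite linear_sum; apply: eq_bigr => a _; rewrite linear_sum.
  by apply: eq_bigr => b _; rewrite linearZ.
by rewrite !scalerBl [RHS]addrC; congr (_ + _); rewrite addrAC.
Qed.

(** If g w = 0 then 0 = <w, c (g w)> = |c w|^2 + (n - p - q) |w|^2, where c is the
    contraction. *)
Lemma metric_mul_inj p q w : bidegree p q w -> (p + q < n)%N ->
  dmul g w = 0 -> w = 0.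
Proof.
move=> hw pq gw0; apply: inner_eq0.
have := inner_metric w (dmul g w).
rewrite (contraction_metric hw) innerDr innerZr gw0 inner0l.
rewrite [inner G w (dmul g _)]innerC inner_metric => /esym/eqP.
have pos : 0 < n%:R - p%:R - q%:R :> R by rewrite -addrA -opprD subr_gt0 -natrD ltr_nat.
rewrite paddr_eq0 ?inner_ge0 ?(mulr_ge0 (ltW pos)) ?inner_ge0 //.
by rewrite mulf_eq0 (gt_eqF pos) => /andP[_ /eqP].
Qed.

Lemma metric_pow_mul_inj m p q w : bidegree p q w -> (p + q + 2 * m <= n.+1)%N ->
  dmul (dpow g m) w = 0 -> w = 0.
Proof.
elim: m p q w => [|m IH] p q w hw le_n; first by rewrite dmul1l.
have -> : dpow g m.+1 = dmul (dpow g m) g.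
  elim: m {IH le_n} => [|m IH]; first by rewrite /= dmul1r dmul1l.
  by rewrite {2}/dpow iterS -dmulA -IH.
rewrite -dmulA => gw0; apply: (metric_mul_inj hw); first lia.
apply: (IH p.+1 q.+1) gw0; last lia.
exact: bidegree_mul bidegree_metric hw.
Qed.

End Euclidean.

(** * Symmetry of second derivatives *)

Section Schwarz.
Variables (R : realType) (V : normedModType R).
Implicit Types (f : V -> R) (x y u v : V).

Lemma is_derive_line f y v (s : R) : differentiable f (s *: v + y) ->
  is_derive s 1 (fun r : R => f (r *: v + y)) ('D_v f (s *: v + y)).
Proof.
move=> /(@diff_derivable _ _ _ _ _ v) df.
have E : (fun h : R => h^-1 *: (((fun r : R => f (r *: v + y)) \o shift s) (h *: 1)
      - f (s *: v + y))) =
    (fun h : R => h^-1 *: ((f \o shift (s *: v + y)) (h *: v) - f (s *: v + y))).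
  by apply/funext => h /=; rewrite [_%:A]mulr1 scalerDl addrA.
by split; rewrite /derivable /derive E.
Qed.

(** The alternating sum of f over the vertices of the parallelogram spanned by
    h u and h v at x. *)
Definition second_difference f x u v (h : R) : R :=
  f (h *: u + (h *: v + x)) - f (h *: u + x) - (f (h *: v + x) - f x).

(** The mean value theorem, applied in the direction u to the difference of f along
    two opposite sides, then in the direction v to the derivative of f. *)
Lemma second_difference_mean f x u v (h : R) : 0 < h ->
  (forall s t, 0 <= s <= h -> 0 <= t <= h ->
     differentiable f (s *: u + (t *: v + x)) /\
     differentiable ('D_u f) (s *: u + (t *: v + x))) ->
  exists s t, [/\ 0 <= s <= h, 0 <= t <= h &
    second_difference f x u v h = 'D_v ('D_u f) (s *: u + (t *: v + x)) * h * h].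
Proof.
move=> h0 df; have h_ge0 := ltW h0.
have h_in : 0 <= h <= h by rewrite h_ge0 lexx.
have z_in : 0 <= (0 : R) <= h by rewrite h_ge0 lexx.
have in_oo (r : R) : r \in `]0, h[ -> 0 <= r <= h.
  by rewrite in_itv => /andP[/ltW-> /ltW->].
have in_cc (r : R) : r \in `[0, h] -> 0 <= r <= h by rewrite in_itv.
pose F := fun s : R => f (s *: u + (h *: v + x)) - f (s *: u + (0 *: v + x)).
pose dF := fun s : R => 'D_u f (s *: u + (h *: v + x)) - 'D_u f (s *: u + (0 *: v + x)).
have F_der (s : R) : 0 <= s <= h -> is_derive s 1 F (dF s).
  move=> hs; apply: is_deriveB; apply: is_derive_line.
    by have [] := df s h hs h_in.
  by have [] := df s 0 hs z_in.
have [s s_in Es] : exists2 c, c \in `]0, h[%R & F h - F 0 = dF c * (h - 0).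
  apply: MVT => [|s /in_oo|]; [exact: h0 | exact: F_der |].
  by apply: derivable_within_continuous => s /in_cc /F_der [].
pose K := fun t : R => 'D_u f (t *: v + (s *: u + x)).
pose dK := fun t : R => 'D_v ('D_u f) (t *: v + (s *: u + x)).
have K_der (t : R) : 0 <= t <= h -> is_derive t 1 K (dK t).
  move=> ht; apply: is_derive_line; rewrite addrCA.
  by have [] := df s t (in_oo _ s_in) ht.
have [t t_in Et] : exists2 c, c \in `]0, h[%R & K h - K 0 = dK c * (h - 0).
  apply: MVT => [|t /in_oo|]; [exact: h0 | exact: K_der |].
  by apply: derivable_within_continuous => t /in_cc /K_der [].
exists s, t; split; [exact: in_oo | exact: in_oo |].
move: Es Et; rewrite !subr0 => Es Et.
have -> : second_difference f x u v h = F h - F 0.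
  by rewrite /F /second_difference !scale0r !add0r.
rewrite Es; congr (_ * _); rewrite [_ *: u + _]addrCA -Et /dF /K.
by rewrite !(addrCA (s *: u)).
Qed.

Lemma second_differenceC f x u v h :
  second_difference f x u v h = second_difference f x v u h.
Proof. by rewrite /second_difference addrCA; lra. Qed.

(** The second difference is symmetric in u and v, so that the two mixed
    derivatives agree at some points of each small parallelogram; conclude by
    continuity. *)
Lemma derive_comm f x u v :
  (\forall y \near x, differentiable f y) ->
  (\forall y \near x, differentiable ('D_u f) y) ->
  (\forall y \near x, differentiable ('D_v f) y) ->
  {for x, continuous ('D_v ('D_u f))} -> {for x, continuous ('D_u ('D_v f))} ->
  'D_v ('D_u f) x = 'D_u ('D_v f) x.
Proof.
move=> df duf dvf cvu cuv.
have close (e : R) : 0 < e -> `|'D_v ('D_u f) x - 'D_u ('D_v f) x| <= e + e.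
  move=> e0.
  have /cvgrPdist_le/(_ e e0) cvu_e := cvu.
  have /cvgrPdist_le/(_ e e0) cuv_e := cuv.
  have near_all : \forall y \near x, differentiable f y /\ differentiable ('D_u f) y
      /\ differentiable ('D_v f) y /\ `|'D_v ('D_u f) x - 'D_v ('D_u f) y| <= e
      /\ `|'D_u ('D_v f) x - 'D_u ('D_v f) y| <= e.
    apply: filterI; first exact: df.
    apply: filterI; first exact: duf.
    apply: filterI; first exact: dvf.
    by apply: filterI; [exact: cvu_e | exact: cuv_e].
  have [r /= r0 near_x] := (nbhs_ballP _ _).1 near_all.
  (* With this h the parallelogram at x stays in the ball of radius r. *)
  pose h := r / (`|u| + `|v| + 1).
  have N0 : 0 < `|u| + `|v| + 1 by rewrite ltr_wpDl ?addr_ge0.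
  have h0 : 0 < h by rewrite divr_gt0.
  have in_ball s t : 0 <= s <= h -> 0 <= t <= h -> ball x r (s *: u + (t *: v + x)).
    rewrite -ball_normE /= => /andP[s0 sh] /andP[t0 th].
    have -> : x - (s *: u + (t *: v + x)) = - (s *: u + t *: v).
      by rewrite addrA opprD addrCA subrr addr0.
    rewrite normrN; apply: (le_lt_trans (ler_normD _ _)).
    rewrite !normrZ !ger0_norm //.
    apply: (@le_lt_trans _ _ (h * `|u| + h * `|v|)).
      by rewrite lerD // ler_wpM2r.
    have hN : h * (`|u| + `|v| + 1) = r by rewrite divfK // gt_eqF.
    by rewrite -[ltRHS]hN -mulrDr ltr_pM2l // ltrDl.
  have [|s [t [hs ht E1]]] := @second_difference_mean f x u v h h0.
    by move=> s t hs ht; have [? [? _]] := near_x _ (in_ball s t hs ht); split.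
  have [|t' [s' [ht' hs' E2]]] := @second_difference_mean f x v u h h0.
    move=> t1 s1 ht1 hs1; rewrite addrCA.
    by have [? [_ [? _]]] := near_x _ (in_ball s1 t1 hs1 ht1); split.
  rewrite addrCA in E2.
  have [_ [_ [_ [c1 _]]]] := near_x _ (in_ball s t hs ht).
  have [_ [_ [_ [_ c2]]]] := near_x _ (in_ball s' t' hs' ht').
  move: E2; rewrite -second_differenceC E1 => /(mulIf (lt0r_neq0 h0)).
  move=> /(mulIf (lt0r_neq0 h0)) E; rewrite E in c1.
  set A := 'D_v _ x in c1 *; set B := 'D_u _ x in c2 *; set Q := 'D_u _ _ in c1 c2.
  have -> : A - B = (A - Q) - (B - Q) by ring.
  exact: le_trans (ler_normB _ _) (lerD c1 c2).
apply/eqP; rewrite -subr_eq0 -normr_le0; apply/ler_addgt0Pl => e e0.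
rewrite addr0 [e]splitr; apply: close; lra.
Qed.

End Schwarz.

(** * Smooth functions on an open set *)

Section Smooth.
Variables (R : realType) (n : nat).
Implicit Types (f h : 'rV[R]_n -> R) (x : 'rV[R]_n) (a : 'I_n).

(** Differentiability is defined through the differential picked by a choice
    operator; f and h have the same one because it is unique. *)
Lemma near_eq_differentiable (V W : normedModType R) (f h : V -> W) (x : V) :
  (\forall y \near x, f y = h y) -> differentiable f x -> differentiable h x.
Proof.
move=> fh df; have /diff_locallyP[dfc dfx] := df.
have dhx : h \o shift x = cst (h x) + 'd f x +o_ 0 id.
  apply/eqaddoP => e e0; have /eqaddoP/(_ e e0) := dfx.
  have fh0 : \forall y \near 0, f (y + x) = h (y + x).
    by have := fh; rewrite (near_shift 0) /= subr0.
  have fhx : f x = h x by apply: (nbhs_singleton fh).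
  apply: filterS2 fh0 => y fhy.
  rewrite -[(f \o shift x - _) y]/(f (y + x) - (f x + 'd f x y)).
  by rewrite -[(h \o shift x - _) y]/(h (y + x) - (h x + 'd f x y)) -fhy -fhx.
have E := diff_unique dfc dhx.
by apply/diff_locallyP; rewrite E.
Qed.

Lemma partialD a f h x : differentiable f x -> differentiable h x ->
  partial a (fun y => f y + h y) x = partial a f x + partial a h x.
Proof. by move=> df dh; apply: deriveD; apply: diff_derivable. Qed.

Lemma partialN a f x : differentiable f x ->
  partial a (fun y => - f y) x = - partial a f x.
Proof. by move=> df; apply: deriveN; apply: diff_derivable. Qed.

Lemma partialM a f h x : differentiable f x -> differentiable h x ->
  partial a (fun y => f y * h y) x = partial a f x * h x + f x * partial a h x.
Proof.
move=> df dh; rewrite /partial.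
rewrite [LHS](@deriveM _ _ f h x); [|exact: diff_derivable|exact: diff_derivable].
by rewrite addrC; congr (_ + _); apply: mulrC.
Qed.

Lemma partialV a f x : differentiable f x -> f x != 0 ->
  partial a (fun y => (f y)^-1) x = - ((f x)^-1 * (f x)^-1 * partial a f x).
Proof.
move=> df f0; rewrite /partial deriveV //; last exact: diff_derivable.
by rewrite -exprVn expr2; apply: mulNr.
Qed.

Lemma partial_cst a (k : R) x : partial a (fun=> k) x = 0.
Proof. exact: derive_cst. Qed.

Lemma differentiable_bigsum (T : Type) (r : seq T) (P : pred T)
    (F : T -> 'rV[R]_n -> R) x : (forall i, P i -> differentiable (F i) x) ->
  differentiable (fun y => \sum_(i <- r | P i) F i y) x.
Proof.
move=> dF; elim: r => [|i r IH].
  rewrite (_ : (fun y => _) = cst 0); first exact: differentiable_cst.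
  by apply/funext => y; rewrite big_nil.
rewrite (_ : (fun y => _) = if P i then
  F i + (fun y => \sum_(i <- r | P i) F i y) else fun y => \sum_(i <- r | P i) F i y).
  case: ifP => // Pi; apply: differentiableD; [exact: dF | exact: IH].
by apply/funext => y; rewrite big_cons; case: ifP.
Qed.

Lemma partial_bigsum a (T : Type) (r : seq T) (P : pred T)
    (F : T -> 'rV[R]_n -> R) x : (forall i, P i -> differentiable (F i) x) ->
  partial a (fun y => \sum_(i <- r | P i) F i y) x =
  \sum_(i <- r | P i) partial a (F i) x.
Proof.
move=> dF; elim: r => [|i r IH].
  rewrite [RHS]big_nil -[RHS](partial_cst a 0 x); congr (partial a _ x).
  by apply/funext => y; rewrite big_nil.
rewrite [RHS]big_cons -IH; case: ifP => Pi.
  rewrite -partialD; [|exact: dF|exact: differentiable_bigsum].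
  by congr (partial a _ x); apply/funext => y; rewrite big_cons Pi.
by congr (partial a _ x); apply/funext => y; rewrite big_cons Pi.
Qed.

Variable U : set 'rV[R]_n.
Hypothesis U_open : open U.

Lemma near_open x : U x -> \forall y \near x, U y.
Proof. by move=> Ux; apply: open_nbhs_nbhs; split. Qed.

Lemma partial_eq_on a f h x : (forall y, U y -> f y = h y) -> U x ->
  partial a f x = partial a h x.
Proof.
move=> fh Ux; apply: near_eq_derive.
by apply: filterS (near_open Ux).
Qed.

Lemma smooth_differentiable f x : smooth_on U f -> U x -> differentiable f x.
Proof. by move=> sf Ux; apply: (sf [::]). Qed.

(** The least class of functions containing the smooth ones and stable under the
    operations to be studied.  It is stable under partial derivatives and made of
    differentiable functions, hence of smooth ones: this proves at once that
    smooth functions are stable under each operation. *)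
Inductive smooth_gen : ('rV[R]_n -> R) -> Prop :=
| SmoothBase f : smooth_on U f -> smooth_gen f
| SmoothAdd f h : smooth_gen f -> smooth_gen h -> smooth_gen (fun y => f y + h y)
| SmoothMul f h : smooth_gen f -> smooth_gen h -> smooth_gen (fun y => f y * h y)
| SmoothInv f : smooth_gen f -> (forall y, U y -> f y != 0) ->
    smooth_gen (fun y => (f y)^-1)
| SmoothExt f h : smooth_gen f -> (forall y, U y -> f y = h y) -> smooth_gen h.

Lemma smooth_gen_differentiable f : smooth_gen f ->
  forall x, U x -> differentiable f x.
Proof.
elim=> {f} [f sf x Ux|f h _ IHf _ IHh x Ux|f h _ IHf _ IHh x Ux|f _ IHf f0 x Ux|f h _ IHf fh x Ux].
- exact: (sf [::]).
- by apply: differentiableD; [exact: IHf | exact: IHh].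
- by apply: differentiableM; [exact: IHf | exact: IHh].
- by apply: differentiableV; [exact: IHf | exact: f0].
- apply: (near_eq_differentiable _ (IHf x Ux)).
  by apply: filterS (near_open Ux).
Qed.

Lemma smooth_gen_cst (k : R) : smooth_gen (fun=> k).
Proof.
apply: SmoothBase => s x Ux.
suff [k' ->] : exists k', foldr (@partial R n) (fun=> k) s = (fun=> k').
  exact: differentiable_cst.
elim: s => [|a s [k' IH]]; first by exists k.
by exists 0; rewrite /= IH; apply/funext => y; apply: partial_cst.
Qed.

Lemma smooth_gen_partial a f : smooth_gen f -> smooth_gen (partial a f).
Proof.
move=> gf; suff [h gh hE] : exists2 h, smooth_gen h &
    forall y, U y -> h y = partial a f y by apply: SmoothExt gh hE.
elim: gf => {f} [f sf|f h gf [f' gf' Ef] gh [h' gh' Eh]|f h gf [f' gf' Ef] gh [h' gh' Eh]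
  |f gf [f' gf' Ef] f0|f h gf [f' gf' Ef] fh].
- exists (partial a f) => //; apply: SmoothBase => s x Ux.
  by have := sf (rcons s a) x Ux; rewrite foldr_rcons.
- exists (fun y => f' y + h' y); first exact: SmoothAdd.
  move=> y Uy; rewrite Ef // Eh // partialD //; exact: smooth_gen_differentiable.
- exists (fun y => f' y * h y + f y * h' y).
    by apply: SmoothAdd; apply: SmoothMul.
  move=> y Uy; rewrite Ef // Eh // partialM //; exact: smooth_gen_differentiable.
- exists (fun y => (-1) * ((f y)^-1 * (f y)^-1 * f' y)).
    apply: SmoothMul; first exact: smooth_gen_cst.
    by apply: SmoothMul => //; apply: SmoothMul; apply: SmoothInv.
  move=> y Uy; rewrite Ef // partialV ?mulN1r //; last exact: f0.
  exact: smooth_gen_differentiable.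
- exists f' => // y Uy; rewrite Ef //; exact: partial_eq_on.
Qed.

Lemma smooth_genP f : smooth_gen f -> smooth_on U f.
Proof.
move=> + s; elim/last_ind: s f => [|s a IH] f gf x Ux.
  exact: smooth_gen_differentiable.
by rewrite foldr_rcons; apply: IH => //; apply: smooth_gen_partial.
Qed.

Lemma smooth_cst (k : R) : smooth_on U (fun=> k).
Proof. exact/smooth_genP/smooth_gen_cst. Qed.

Lemma smooth_partial a f : smooth_on U f -> smooth_on U (partial a f).
Proof. by move=> sf; apply/smooth_genP/smooth_gen_partial/SmoothBase. Qed.

Lemma smoothD f h : smooth_on U f -> smooth_on U h -> smooth_on U (fun y => f y + h y).
Proof. by move=> sf sh; apply/smooth_genP/SmoothAdd; apply: SmoothBase. Qed.

Lemma smoothM f h : smooth_on U f -> smooth_on U h -> smooth_on U (fun y => f y * h y).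
Proof. by move=> sf sh; apply/smooth_genP/SmoothMul; apply: SmoothBase. Qed.

Lemma smoothV f : smooth_on U f -> (forall y, U y -> f y != 0) ->
  smooth_on U (fun y => (f y)^-1).
Proof. by move=> sf f0; apply/smooth_genP/SmoothInv => //; apply: SmoothBase. Qed.

Lemma smooth_eq_on f h : (forall y, U y -> f y = h y) -> smooth_on U f -> smooth_on U h.
Proof. by move=> fh sf; apply: smooth_genP; apply: SmoothExt fh; apply: SmoothBase. Qed.

Lemma smoothN f : smooth_on U f -> smooth_on U (fun y => - f y).
Proof.
move=> sf; apply: smooth_eq_on (smoothM (smooth_cst (-1)) sf) => y _.
by rewrite mulN1r.
Qed.

Lemma smooth_sum (T : Type) (r : seq T) (P : pred T) (F : T -> 'rV[R]_n -> R) :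
  (forall i, P i -> smooth_on U (F i)) ->
  smooth_on U (fun y => \sum_(i <- r | P i) F i y).
Proof.
move=> sF; elim: r => [|i r IH].
  by apply: smooth_eq_on (smooth_cst 0) => y _; rewrite big_nil.
have [Pi|nPi] := boolP (P i).
  apply: smooth_eq_on (smoothD (sF i Pi) IH) => y _.
  by rewrite big_cons Pi.
by apply: smooth_eq_on IH => y _; rewrite big_cons (negbTE nPi).
Qed.

Lemma smooth_prod (T : Type) (r : seq T) (P : pred T) (F : T -> 'rV[R]_n -> R) :
  (forall i, P i -> smooth_on U (F i)) ->
  smooth_on U (fun y => \prod_(i <- r | P i) F i y).
Proof.
move=> sF; elim: r => [|i r IH].
  by apply: smooth_eq_on (smooth_cst 1) => y _; rewrite big_nil.
have [Pi|nPi] := boolP (P i).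
  apply: smooth_eq_on (smoothM (sF i Pi) IH) => y _.
  by rewrite big_cons Pi.
by apply: smooth_eq_on IH => y _; rewrite big_cons (negbTE nPi).
Qed.

Lemma smooth_det m (A : 'rV[R]_n -> 'M[R]_m) :
  (forall i j, smooth_on U (fun y => A y i j)) -> smooth_on U (fun y => \det (A y)).
Proof.
move=> sA; apply: smooth_sum => s _; apply: smoothM; first exact: smooth_cst.
by apply: smooth_prod => i _.
Qed.

Lemma smooth_invmx m (A : 'rV[R]_n -> 'M[R]_m) i j :
  (forall y, U y -> A y \in unitmx) -> (forall i j, smooth_on U (fun y => A y i j)) ->
  smooth_on U (fun y => invmx (A y) i j).
Proof.
move=> uA sA.
apply: (@smooth_eq_on (fun y => (\det (A y))^-1 * ((-1) ^+ (j + i) *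
    \det (row' j (col' i (A y)))))).
  by move=> y Uy; rewrite /invmx uA // !mxE.
apply: smoothM.
  apply: smoothV; first exact: smooth_det.
  by move=> y Uy; have := uA y Uy; rewrite unitmxE unitfE.
apply: smoothM; first exact: smooth_cst.
apply: smooth_det => i' j'; apply: smooth_eq_on (sA (lift j i') (lift i j')).
by move=> y _; rewrite !mxE.
Qed.

Lemma partialC a b f x : smooth_on U f -> U x ->
  partial a (partial b f) x = partial b (partial a f) x.
Proof.
move=> sf Ux; have near_diff h : smooth_on U h -> \forall y \near x, differentiable h y.
  by move=> sh; apply: filterS (near_open Ux) => y; apply: smooth_differentiable.
apply: derive_comm.
- exact: near_diff.
- exact: near_diff (smooth_partial b sf).
- exact: near_diff (smooth_partial a sf).
- apply: differentiable_continuous.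
  exact: smooth_differentiable (smooth_partial a (smooth_partial b sf)) Ux.
- apply: differentiable_continuous.
  exact: smooth_differentiable (smooth_partial b (smooth_partial a sf)) Ux.
Qed.

End Smooth.

(** * The Levi-Civita connection on double forms *)

Section LeviCivita.
Variables (R : realType) (n : nat) (U : set 'rV[R]_n) (g : 'rV[R]_n -> 'M[R]_n).
Hypothesis U_open : open U.
Hypothesis g_smooth : forall i j, smooth_on U (fun x => g x i j).
Hypothesis g_pos : forall x, U x -> posdef (g x).
Implicit Types (x y : 'rV[R]_n) (a b c d i j k l m : 'I_n).
Implicit Types (w t : 'rV[R]_n -> dform R n) (v s : dform R n).

Local Notation dl a := (dbase R [set a] set0).
Local Notation dr a := (dbase R set0 [set a]).
Local Notation H x := (invmx (g x)).
Local Notation Gam := (christoffel g).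

Let diffU (f : 'rV[R]_n -> R) x : smooth_on U f -> U x -> differentiable f x.
Proof. exact: smooth_differentiable. Qed.

Lemma smooth_inv_metric i j : smooth_on U (fun x => H x i j).
Proof.
apply: smooth_invmx => // y Uy; apply: metric_unit; exact: g_pos.
Qed.

Lemma smooth_christoffel c a b : smooth_on U (Gam c a b).
Proof.
apply: smoothM => //; first exact: smooth_cst.
apply: smooth_sum => // d _; apply: smoothM => //; first exact: smooth_inv_metric.
apply: smoothD => //; last by apply: smoothN => //; apply: smooth_partial.
by apply: smoothD => //; apply: smooth_partial.
Qed.

Lemma partial_metricC a i j x : U x ->
  partial a (fun y => g y i j) x = partial a (fun y => g y j i) x.
Proof.
by move=> Ux; apply: (partial_eq_on U_open) => // y Uy; apply: metricC; apply: g_pos.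
Qed.

Lemma christoffelC c a b x : U x -> Gam c a b x = Gam c b a x.
Proof.
move=> Ux; rewrite /christoffel; congr (_ * _); apply: eq_bigr => d _.
by rewrite (partial_metricC d a b Ux) [X in X - _]addrC.
Qed.

(** The Christoffel symbols of the first kind. *)
Definition christoffel1 k a b x : R := \sum_c g x k c * Gam c a b x.

Lemma christoffel1E k a b x : U x -> christoffel1 k a b x =
  2^-1 * (partial a (fun y => g y k b) x + partial b (fun y => g y k a) x
          - partial k (fun y => g y a b) x).
Proof.
move=> Ux; rewrite /christoffel1 /christoffel.
under eq_bigr => c _ do rewrite mulrCA mulr_sumr.
rewrite -mulr_sumr; congr (_ * _); rewrite exchange_big /=.
set F := fun d => partial a (fun y => g y d b) x + partial b (fun y => g y d a) x
          - partial d (fun y => g y a b) x.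
rewrite -[RHS]/(F k : R^o) -(@sum_delta _ _ _ k (F : _ -> R^o)).
apply: eq_bigr => d _; rewrite -(metricK (g_pos Ux)) -[RHS]/(_ * _) mulr_suml.
by apply: eq_bigr => c _; rewrite mulrA.
Qed.

Lemma metric_compat a i j x : U x ->
  partial a (fun y => g y i j) x = christoffel1 i a j x + christoffel1 j a i x.
Proof.
move=> Ux; rewrite !christoffel1E //.
rewrite (partial_metricC a j i Ux) (partial_metricC i a j Ux).
by rewrite (partial_metricC j a i Ux); field.
Qed.

(** Differentiate G^-1 G = 1. *)
Lemma inv_metric_compat a i j x : U x -> partial a (fun y => H y i j) x =
  - (\sum_m Gam i a m x * H x m j) - \sum_m H x i m * Gam j a m x.
Proof.
move=> Ux; have gx := g_pos Ux.
have HG p q : \sum_r partial a (fun y => H y p r) x * g x r q =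
    - \sum_r H x p r * partial a (fun y => g y r q) x.
  apply/eqP; rewrite -addr_eq0 -big_split /=; apply/eqP.
  transitivity (partial a (fun y => \sum_r H y p r * g y r q) x).
    rewrite partial_bigsum => [|r _]; last first.
      apply: differentiableM; apply: diffU => //; exact: smooth_inv_metric.
    apply: eq_bigr => r _; rewrite partialM //; apply: diffU => //.
    exact: smooth_inv_metric.
  rewrite -[RHS](partial_cst a ((p == q)%:R) x); apply: (partial_eq_on U_open) => // y Uy.
  exact: inv_metricK (g_pos Uy) _ _.
transitivity (\sum_q (\sum_r partial a (fun y => H y i r) x * g x r q) * H x q j).
  under eq_bigr do rewrite mulr_suml.
  rewrite exchange_big /= (bigD1 j) //= [X in _ = _ + X]big1 ?addr0 => [|r rj].
    under eq_bigr do rewrite -mulrA.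
    by rewrite -mulr_sumr metricK // eqxx mulr1.
  under eq_bigr do rewrite -mulrA.
  by rewrite -mulr_sumr metricK // (negbTE rj) mulr0.
under eq_bigr => q _ do rewrite HG.
transitivity (- \sum_q \sum_r H x i r * H x q j * christoffel1 r a q x
  - \sum_q \sum_r H x i r * H x q j * christoffel1 q a r x).
  rewrite -opprD -big_split -sumrN; apply: eq_bigr => q _.
  rewrite -big_split mulNr mulr_suml; congr (- _); apply: eq_bigr => r _.
  by rewrite metric_compat //=; ring.
congr (- _ - _).
  apply: eq_bigr => q _; rewrite /christoffel1.
  transitivity (\sum_c (i == c)%:R * (Gam c a q x * H x q j) : R).
    under eq_bigr do rewrite mulr_sumr.
    rewrite exchange_big; apply: eq_bigr => c _; rewrite -(inv_metricK gx) mulr_suml.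
    by apply: eq_bigr => r _; ring.
  exact: (@sum_delta _ R^o).
rewrite exchange_big; apply: eq_bigr => r _; rewrite /christoffel1 /=.
transitivity (\sum_c (j == c)%:R * (H x i r * Gam c a r x) : R).
  under eq_bigr do rewrite mulr_sumr.
  rewrite exchange_big; apply: eq_bigr => c _; rewrite -(inv_metricK gx) mulr_suml.
  by apply: eq_bigr => q _; rewrite (inv_metricC gx j q); ring.
exact: (@sum_delta _ R^o).
Qed.

Definition smooth_form w := forall u, smooth_on U (fun y => w y u).

Lemma smooth_form_cst v : smooth_form (fun=> v).
Proof. by move=> u; apply: smooth_cst. Qed.

Lemma smooth_form_eq w t : (forall y, U y -> w y = t y) -> smooth_form w -> smooth_form t.
Proof. by move=> wt sw u; apply: smooth_eq_on (sw u) => // y Uy; rewrite wt. Qed.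

Lemma smooth_formZ (f : 'rV[R]_n -> R) w : smooth_on U f -> smooth_form w ->
  smooth_form (fun y => f y *: w y).
Proof.
move=> sf sw u; apply: smooth_eq_on (smoothM U_open sf (sw u)) => // y _.
by rewrite dform_scaleE.
Qed.

Lemma smooth_formD w t : smooth_form w -> smooth_form t ->
  smooth_form (fun y => w y + t y).
Proof.
move=> sw st u; apply: smooth_eq_on (smoothD U_open (sw u) (st u)) => // y _.
by rewrite dform_addE.
Qed.

Lemma smooth_form_sum (T : Type) (r : seq T) (P : pred T) (F : T -> 'rV[R]_n -> dform R n) :
  (forall p, P p -> smooth_form (F p)) -> smooth_form (fun y => \sum_(p <- r | P p) F p y).
Proof.
move=> sF u; apply: smooth_eq_on (smooth_sum U_open r (fun p Pp => sF p Pp u)) => // y _.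
by rewrite dform_sumE.
Qed.

Lemma smooth_form_mul w t : smooth_form w -> smooth_form t ->
  smooth_form (fun y => dmul (w y) (t y)).
Proof.
move=> sw st u; apply: smooth_eq_on; [exact: U_open | by move=> y _; rewrite dmulE |].
apply: smooth_sum => // A _; apply: smooth_sum => // B _.
apply: smoothM => //; apply: smoothM => //; exact: smooth_cst.
Qed.

Lemma smooth_form_pow w (k : nat) : smooth_form w -> smooth_form (fun y => dpow (w y) k).
Proof.
move=> sw; elim: k => [|k IH]; first exact: smooth_form_cst.
exact: smooth_form_mul.
Qed.

Definition dpartial a w x : dform R n := [ffun u => partial a (fun y => w y u) x].

Lemma dpartialE a w x u : dpartial a w x u = partial a (fun y => w y u) x.
Proof. by rewrite ffunE. Qed.

Lemma dpartial_cst a v x : dpartial a (fun=> v) x = 0.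
Proof. by apply/ffunP => u; rewrite dpartialE partial_cst ffunE. Qed.

Lemma dpartial_eq_on a w t x : (forall y, U y -> w y = t y) -> U x ->
  dpartial a w x = dpartial a t x.
Proof.
move=> wt Ux; apply/ffunP => u; rewrite !dpartialE.
by apply: (partial_eq_on U_open) => // y Uy; rewrite wt.
Qed.

Lemma dpartialD a w t x : smooth_form w -> smooth_form t -> U x ->
  dpartial a (fun y => w y + t y) x = dpartial a w x + dpartial a t x.
Proof.
move=> sw st Ux; apply/ffunP => u; rewrite dform_addE !dpartialE -partialD;
  [|exact: diffU|exact: diffU].
by congr (partial a _ x); apply/funext => y; rewrite dform_addE.
Qed.

Lemma dpartial_sum a (T : Type) (r : seq T) (P : pred T)
    (F : T -> 'rV[R]_n -> dform R n) x :
  (forall p, P p -> smooth_form (F p)) -> U x ->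
  dpartial a (fun y => \sum_(p <- r | P p) F p y) x =
  \sum_(p <- r | P p) dpartial a (F p) x.
Proof.
move=> sF Ux; apply/ffunP => u; rewrite dform_sumE dpartialE.
under [RHS]eq_bigr do rewrite dpartialE.
rewrite -partial_bigsum => [|p Pp]; last by apply: diffU => //; apply: sF.
by congr (partial a _ x); apply/funext => y; rewrite dform_sumE.
Qed.

Lemma dpartialZ a (f : 'rV[R]_n -> R) w x : smooth_on U f -> smooth_form w -> U x ->
  dpartial a (fun y => f y *: w y) x = partial a f x *: w x + f x *: dpartial a w x.
Proof.
move=> sf sw Ux; apply/ffunP => u.
rewrite dform_addE !dform_scaleE !dpartialE -partialM; [|exact: diffU|exact: diffU].
by congr (partial a _ x); apply/funext => y; rewrite dform_scaleE.
Qed.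

Lemma dpartial_mul a w t x : smooth_form w -> smooth_form t -> U x ->
  dpartial a (fun y => dmul (w y) (t y)) x =
  dmul (dpartial a w x) (t x) + dmul (w x) (dpartial a t x).
Proof.
move=> sw st Ux; have E y : dmul (w y) (t y) =
    \sum_p w y p *: dmul (dbase R p.1 p.2) (t y).
  by rewrite {1}(dform_expand (w y)) dmul_suml; apply: eq_bigr => p _; rewrite dmulZl.
have E2 p y : dmul (dbase R p.1 p.2) (t y) =
    \sum_q t y q *: dmul (dbase R p.1 p.2) (dbase R q.1 q.2).
  by rewrite {1}(dform_expand (t y)) linear_sum; apply: eq_bigr => q _; rewrite linearZ.
rewrite (dpartial_eq_on _ (t := fun y => \sum_p w y p *: dmul (dbase R p.1 p.2) (t y))) //.
have sm p : smooth_form (fun y => dmul (dbase R p.1 p.2) (t y)).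
  exact: smooth_form_mul (smooth_form_cst _) st.
rewrite dpartial_sum // => [|p _]; last exact: smooth_formZ.
rewrite {1}(dform_expand (dpartial a w x)) {1}(dform_expand (w x)) !dmul_suml -big_split.
apply: eq_bigr => p _ /=; rewrite dpartialZ // !dmulZl dpartialE; congr (_ + _ *: _).
rewrite (dpartial_eq_on _ (t := fun y =>
  \sum_q t y q *: dmul (dbase R p.1 p.2) (dbase R q.1 q.2))) //.
rewrite dpartial_sum // => [|q _]; last by apply: smooth_formZ => //; apply: smooth_form_cst.
rewrite {1}(dform_expand (dpartial a t x)) linear_sum; apply: eq_bigr => q _ /=.
rewrite dpartialZ //; last exact: smooth_form_cst.
by rewrite dpartial_cst scaler0 addr0 dpartialE linearZ.
Qed.

(** The zeroth-order part of nabla_a, which is algebraic: nabla_a is d/dx^a minus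
    this derivation. *)
Definition connection a x v : dform R n :=
  \sum_i \sum_b Gam i a b x *:
    (dmul (dl b) (contrl i v) + dmul (dr b) (contrr i v)).

Lemma nablaE a w x : nabla g a w x = dpartial a w x - connection a x (w x).
Proof. by []. Qed.

Lemma connection_is_linear a x : linear (connection a x).
Proof.
move=> k v s; rewrite /connection scaler_sumr -big_split; apply: eq_bigr => i _ /=.
rewrite scaler_sumr -big_split; apply: eq_bigr => b _ /=.
rewrite !linearD !linearZ /= ?scalerDr !scalerA [k * _]mulrC.
by rewrite addrACA.
Qed.
HB.instance Definition _ a x :=
  GRing.isLinear.Build R (dform R n) (dform R n) _ (connection a x) (connection_is_linear a x).

Lemma connectionD a x v s : connection a x (v + s) = connection a x v + connection a x s.
Proof. exact: linearD. Qed.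

Lemma connectionZ a x (k : R) v : connection a x (k *: v) = k *: connection a x v.
Proof. exact: linearZ. Qed.

Lemma connection_sum a x (T : Type) (r : seq T) (P : pred T) (F : T -> dform R n) :
  connection a x (\sum_(p <- r | P p) F p) = \sum_(p <- r | P p) connection a x (F p).
Proof. exact: linear_sum. Qed.

Lemma connection_unit a x : connection a x (dunit R n) = 0.
Proof.
rewrite /connection big1 // => i _; rewrite big1 // => b _.
by rewrite contrl_unit contrr_unit !linear0 addr0 scaler0.
Qed.

Lemma connection_swap a x v : connection a x (dswap v) = dswap (connection a x v).
Proof.
rewrite linear_sum; apply: eq_bigr => i _; rewrite linear_sum; apply: eq_bigr => b _.
rewrite /= dswapZ dswapD dswap_dl dswap_dr dswap_contrl dswap_contrr.
by rewrite addrC.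
Qed.

Lemma connection_dl a x k v : connection a x (dmul (dl k) v) =
  \sum_b Gam k a b x *: dmul (dl b) v + dmul (dl k) (connection a x v).
Proof.
rewrite -(@sum_delta _ _ _ k (fun i => \sum_b Gam i a b x *: dmul (dl b) v)).
rewrite /connection dmul_sumr -big_split; apply: eq_bigr => i _ /=.
rewrite dmul_sumr scaler_sumr -big_split; apply: eq_bigr => b _ /=.
rewrite contrl_dl contrr_dl dmulBr dmulZr dmulZr dmulDr dl_dl opprK.
rewrite -dl_dr -addrA [LHS]scalerDr !scalerA mulrC; congr (_ *: _ + _).
by rewrite eq_sym.
Qed.

Lemma connection_dr a x k v : connection a x (dmul (dr k) v) =
  \sum_b Gam k a b x *: dmul (dr b) v + dmul (dr k) (connection a x v).
Proof.
rewrite -{1}[v]dswapK -dswap_dl connection_swap connection_dl linearD linear_sum /=.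
rewrite dswap_dl connection_swap dswapK; congr (_ + _); apply: eq_bigr => b _.
by rewrite linearZ /= dswap_dl dswapK.
Qed.

(** A derivation that agrees with the product rule on generators obeys it
    everywhere. *)
Lemma connection_mul a x v s : connection a x (dmul v s) =
  dmul (connection a x v) s + dmul v (connection a x s).
Proof.
elim/dform_ind: v => [v v' IH IH'|k v IH||c v IH|c v IH].
- by rewrite !(dmulDl, connectionD) IH IH' addrACA.
- by rewrite !(dmulZl, connectionZ) IH scalerDr.
- by rewrite connection_unit dmul0l !dmul1l add0r.
- rewrite -dmulA !connection_dl IH dmulDl dmulDr addrA !dmulA; congr (_ + _ + _).
  by rewrite dmul_suml; apply: eq_bigr => b _; rewrite dmulZl dmulA.
- rewrite -dmulA !connection_dr IH dmulDl dmulDr addrA !dmulA; congr (_ + _ + _).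
  by rewrite dmul_suml; apply: eq_bigr => b _; rewrite dmulZl dmulA.
Qed.

Lemma contrl_connection a x c v : contrl c (connection a x v) =
  connection a x (contrl c v) + \sum_i Gam i a c x *: contrl i v.
Proof.
rewrite linear_sum -big_split; apply: eq_bigr => i _ /=; rewrite linear_sum /=.
rewrite -(@sum_delta _ _ _ c (fun b => Gam i a b x *: contrl i v)) -big_split.
apply: eq_bigr => b _ /=; rewrite contrlZ contrlD contrl_dl contrl_dr.
rewrite contrl_contrl dmulNr opprK contrl_contrr.
by rewrite -addrA [LHS]scalerDr [RHS]addrC !scalerA [_%:R * _]mulrC.
Qed.

Lemma nabla_eq_on a w t x : (forall y, U y -> w y = t y) -> U x ->
  nabla g a w x = nabla g a t x.
Proof. by move=> wt Ux; rewrite !nablaE (dpartial_eq_on a wt Ux) wt. Qed.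

Lemma nablaD a w t x : smooth_form w -> smooth_form t -> U x ->
  nabla g a (fun y => w y + t y) x = nabla g a w x + nabla g a t x.
Proof. by move=> sw st Ux; rewrite !nablaE dpartialD // connectionD opprD addrACA. Qed.

Lemma nablaZ a (f : 'rV[R]_n -> R) w x : smooth_on U f -> smooth_form w -> U x ->
  nabla g a (fun y => f y *: w y) x = partial a f x *: w x + f x *: nabla g a w x.
Proof.
by move=> sf sw Ux; rewrite !nablaE dpartialZ // connectionZ scalerBr addrA.
Qed.

Lemma nabla_sum a (T : Type) (r : seq T) (P : pred T) (F : T -> 'rV[R]_n -> dform R n) x :
  (forall p, P p -> smooth_form (F p)) -> U x ->
  nabla g a (fun y => \sum_(p <- r | P p) F p y) x =
  \sum_(p <- r | P p) nabla g a (F p) x.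
Proof.
move=> sF Ux; rewrite nablaE dpartial_sum //= connection_sum -sumrN -big_split.
by apply: eq_bigr.
Qed.

Lemma nabla_mul a w t x : smooth_form w -> smooth_form t -> U x ->
  nabla g a (fun y => dmul (w y) (t y)) x =
  dmul (nabla g a w x) (t x) + dmul (w x) (nabla g a t x).
Proof.
move=> sw st Ux; rewrite !nablaE dpartial_mul // connection_mul dmulBl dmulBr.
by rewrite opprD addrACA.
Qed.

Lemma nabla_cst a v x : nabla g a (fun=> v) x = - connection a x v.
Proof. by rewrite nablaE dpartial_cst sub0r. Qed.

Lemma nabla_swap a w x : nabla g a (fun y => dswap (w y)) x = dswap (nabla g a w x).
Proof.
rewrite !nablaE connection_swap linearB /=; congr (_ - _).
apply/ffunP => -[A B]; rewrite dswapE !dpartialE; congr (partial a _ x).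
by apply/funext => y; rewrite dswapE.
Qed.

Lemma bidegree_connection a x p q v : bidegree p q v -> bidegree p q (connection a x v).
Proof.
move=> hv; apply: bidegree_sum => i _; apply: bidegree_sum => b _.
apply: bidegreeZ; apply: bidegreeD.
  case: p hv => [|p] hv; first by rewrite (contrl_bidegree0 i hv) linear0; apply: bidegree0.
  by apply: bidegree_dl; apply: bidegree_contrl.
case: q hv => [|q] hv; first by rewrite (contrr_bidegree0 i hv) linear0; apply: bidegree0.
by apply: bidegree_dr; apply: bidegree_contrr.
Qed.

Lemma bidegree_nabla a w x p q : (forall y, U y -> bidegree p q (w y)) -> U x ->
  bidegree p q (nabla g a w x).
Proof.
move=> hw Ux; apply: bidegreeD; last first.
  by apply: bidegreeN; apply: bidegree_connection; apply: hw.
move=> I J IJ; rewrite dpartialE -[RHS](partial_cst a 0 x).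
by apply: (partial_eq_on U_open) => // y Uy; apply: hw.
Qed.

Local Notation gform y := (metric_form (g y)).

Lemma smooth_metric_form : smooth_form (fun y => gform y).
Proof.
apply: smooth_form_sum => i _; apply: smooth_form_sum => j _.
apply: smooth_formZ => //; exact: smooth_form_cst.
Qed.

Lemma base11 i j : dbase R [set i] [set j] = dmul (dl i) (dmul (dr j) (dunit R n)).
Proof. by rewrite dmul1r dl_base eps0r scale1r setU0. Qed.

(** The two terms by which the connection acts on g_ij dx^i (x) dx^j are the two
    Christoffel symbols of the first kind that add up to the derivative of g_ij. *)
Lemma nabla_metric a x : U x -> nabla g a (fun y => gform y) x = 0.
Proof.
move=> Ux; rewrite nablaE dpartial_sum // => [|i _]; last first.
  apply: smooth_form_sum => j _; apply: smooth_formZ => //; exact: smooth_form_cst.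
pose X i j : dform R n := dbase R [set i] [set j].
transitivity (\sum_i \sum_j partial a (fun y => g y i j) x *: X i j - connection a x (gform x)).
  congr (_ - _); apply: eq_bigr => i _; rewrite dpartial_sum // => [|j _]; last first.
    by apply: smooth_formZ => //; apply: smooth_form_cst.
  apply: eq_bigr => j _; rewrite dpartialZ //; last exact: smooth_form_cst.
  by rewrite dpartial_cst scaler0 addr0.
have conn_base i j : connection a x (X i j) =
    \sum_b Gam i a b x *: X b j + \sum_b Gam j a b x *: X i b.
  rewrite /X base11 connection_dl connection_dr connection_unit dmul0r addr0.
  rewrite dmul_sumr; congr (_ + _); apply: eq_bigr => b _; rewrite base11 //.
  by rewrite dmulZr.
have -> : connection a x (gform x) =
    \sum_i \sum_j \sum_b (g x i j * Gam i a b x) *: X b j +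
    \sum_i \sum_j \sum_b (g x i j * Gam j a b x) *: X i b.
  rewrite connection_sum -big_split; apply: eq_bigr => i _ /=.
  rewrite connection_sum -big_split; apply: eq_bigr => j _ /=.
  rewrite connectionZ conn_base scalerDr !scaler_sumr.
  by congr (_ + _); apply: eq_bigr => b _; rewrite scalerA.
have -> : \sum_i \sum_j \sum_b (g x i j * Gam i a b x) *: X b j =
    \sum_i \sum_j christoffel1 j a i x *: X i j.
  transitivity (\sum_j \sum_i \sum_b (g x i j * Gam i a b x) *: X b j).
    by rewrite exchange_big.
  rewrite [RHS]exchange_big; apply: eq_bigr => j _ /=; rewrite exchange_big.
  apply: eq_bigr => b _ /=; rewrite -scaler_suml; congr (_ *: _).
  by apply: eq_bigr => c _; rewrite (metricC (g_pos Ux)).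
have -> : \sum_i \sum_j \sum_b (g x i j * Gam j a b x) *: X i b =
    \sum_i \sum_j christoffel1 i a j x *: X i j.
  apply: eq_bigr => i _; rewrite exchange_big; apply: eq_bigr => b _ /=.
  by rewrite -scaler_suml.
apply/eqP; rewrite subr_eq0 -big_split; apply/eqP; apply: eq_bigr => i _ /=.
rewrite -big_split; apply: eq_bigr => j _ /=.
by rewrite -scalerDl (metric_compat a i j Ux) [in RHS]addrC.
Qed.

Lemma smooth_metric_pow (k : nat) : smooth_form (fun y => dpow (gform y) k).
Proof. exact: smooth_form_pow smooth_metric_form. Qed.

Lemma nabla_metric_pow a (k : nat) x : U x -> nabla g a (fun y => dpow (gform y) k) x = 0.
Proof.
move=> Ux; elim: k => [|k IH]; first by rewrite nabla_cst connection_unit oppr0.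
rewrite (@nabla_mul a (fun y => gform y) (fun y => dpow (gform y) k)) //.
- by rewrite nabla_metric // IH dmul0l dmul0r addr0.
- exact: smooth_metric_form.
- exact: smooth_metric_pow.
Qed.

(** The scalar product of two forms with constant coefficients depends on the
    point through g only.  By induction on v: when v is multiplied by dx^c, the
    adjunction [inner_dl] replaces it by a contraction of s, the derivative of
    G^-1 gives the action of the connection on dx^c, and the rest is the
    commutator of the connection with a contraction. *)
Lemma inner_cst v : forall s, smooth_on U (fun y => inner (g y) v s) /\
  forall x a, U x -> partial a (fun y => inner (g y) v s) x =
    - inner (g x) (connection a x v) s - inner (g x) v (connection a x s).
Proof.
have swapP v0 : (forall s, smooth_on U (fun y => inner (g y) v0 s) /\
    forall x a, U x -> partial a (fun y => inner (g y) v0 s) x =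
    - inner (g x) (connection a x v0) s - inner (g x) v0 (connection a x s)) ->
  forall s, smooth_on U (fun y => inner (g y) (dswap v0) s) /\
    forall x a, U x -> partial a (fun y => inner (g y) (dswap v0) s) x =
    - inner (g x) (connection a x (dswap v0)) s - inner (g x) (dswap v0) (connection a x s).
  move=> IH s; have E y : inner (g y) (dswap v0) s = inner (g y) v0 (dswap s).
    exact: inner_swapl.
  have [sm der] := IH (dswap s); split.
    by apply: smooth_eq_on sm => // y _; rewrite E.
  move=> x a Ux; rewrite (_ : (fun y => _) = fun y => inner (g y) v0 (dswap s)); last exact/funext.
  by rewrite der // !connection_swap !inner_swapl.
have dlP v0 c : (forall s, smooth_on U (fun y => inner (g y) v0 s) /\
    forall x a, U x -> partial a (fun y => inner (g y) v0 s) x =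
    - inner (g x) (connection a x v0) s - inner (g x) v0 (connection a x s)) ->
  forall s, smooth_on U (fun y => inner (g y) (dmul (dl c) v0) s) /\
    forall x a, U x -> partial a (fun y => inner (g y) (dmul (dl c) v0) s) x =
    - inner (g x) (connection a x (dmul (dl c) v0)) s
    - inner (g x) (dmul (dl c) v0) (connection a x s).
  move=> IH s; have E y : U y -> \sum_b H y c b * inner (g y) v0 (contrl b s) =
      inner (g y) (dmul (dl c) v0) s by move=> /g_pos gy; rewrite inner_dl.
  have sm b : smooth_on U (fun y => inner (g y) v0 (contrl b s)) by have [] := IH (contrl b s).
  split.
    apply: smooth_eq_on E _ => //; apply: smooth_sum => // b _; apply: smoothM => //.
    exact: smooth_inv_metric.
  move=> x a Ux; rewrite -(partial_eq_on U_open a E) //.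
  rewrite partial_bigsum => [|b _]; last first.
    by apply: differentiableM; apply: diffU => //; apply: smooth_inv_metric.
  have gx := g_pos Ux.
  transitivity (\sum_b (- (\sum_m Gam c a m x * H x m b) * inner (g x) v0 (contrl b s)
     - (\sum_m H x c m * Gam b a m x) * inner (g x) v0 (contrl b s)
     - H x c b * inner (g x) (connection a x v0) (contrl b s)
     - H x c b * inner (g x) v0 (connection a x (contrl b s)))).
    apply: eq_bigr => b _; rewrite partialM; [|exact: diffU (smooth_inv_metric _ _) _|exact: diffU].
    have [_ ->//] := IH (contrl b s); rewrite inv_metric_compat //; ring.
  rewrite connection_dl innerDl // !inner_dl // inner_suml //.
  have -> : \sum_b H x c b * inner (g x) v0 (contrl b (connection a x s)) =
      \sum_b H x c b * inner (g x) v0 (connection a x (contrl b s)) +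
      \sum_b (\sum_m H x c m * Gam b a m x) * inner (g x) v0 (contrl b s).
    have -> : \sum_b (\sum_m H x c m * Gam b a m x) * inner (g x) v0 (contrl b s) =
        \sum_b H x c b * \sum_i Gam i a b x * inner (g x) v0 (contrl i s).
      under eq_bigr => b _ do rewrite mulr_suml.
      rewrite exchange_big; apply: eq_bigr => b _ /=; rewrite mulr_sumr.
      by apply: eq_bigr => i _; rewrite -mulrA.
    rewrite -big_split; apply: eq_bigr => b _ /=.
    rewrite contrl_connection innerDr // mulrDr.
    by congr (_ + _ * _); rewrite inner_sumr; apply: eq_bigr => i _; rewrite innerZr.
  have -> : \sum_i inner (g x) (Gam c a i x *: dmul (dl i) v0) s =
     - \sum_b - (\sum_m Gam c a m x * H x m b) * inner (g x) v0 (contrl b s).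
    under eq_bigr => i _ do rewrite innerZl // inner_dl // mulr_sumr.
    rewrite exchange_big -sumrN; apply: eq_bigr => b _ /=.
    rewrite mulNr opprK mulr_suml.
    by apply: eq_bigr => m _; ring.
  rewrite !sumrB; ring.
elim/dform_ind: v => [v v' IH IH'|k v IH||c v IH|c v IH] s.
- have [sm der] := IH s; have [sm' der'] := IH' s.
  have E y : U y -> inner (g y) v s + inner (g y) v' s = inner (g y) (v + v') s.
    by move=> Uy; rewrite innerDl.
  split; first by apply: smooth_eq_on E _ => //; apply: smoothD.
  move=> x a Ux; rewrite -(partial_eq_on U_open a E) // partialD; [|exact: diffU|exact: diffU].
  rewrite der // der' // connectionD !innerDl; ring.
- have [sm der] := IH s.
  have E y : U y -> k * inner (g y) v s = inner (g y) (k *: v) s.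
    by move=> Uy; rewrite innerZl.
  split; first by apply: smooth_eq_on E _ => //; apply: smoothM => //; apply: smooth_cst.
  move=> x a Ux; rewrite -(partial_eq_on U_open a E) // partialM; [|exact: differentiable_cst|exact: diffU].
  rewrite partial_cst der // connectionZ !innerZl; ring.
- have E y : U y -> s (set0, set0) = inner (g y) (dunit R n) s.
    by move=> Uy; rewrite inner_unit.
  split; first by apply: smooth_eq_on E _ => //; apply: smooth_cst.
  move=> x a Ux; rewrite -(partial_eq_on U_open a E) // partial_cst.
  rewrite connection_unit inner0l inner_unit.
  rewrite /connection dform_sumE big1 ?subr0 ?oppr0 // => i _.
  rewrite dform_sumE big1 // => b _.
  by rewrite dform_scaleE dform_addE dlE drE !inE addr0 mulr0.
- exact: dlP.
- have := swapP _ (dlP _ c (swapP _ IH)) s.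
  by rewrite dswap_dl dswapK.
Qed.

Lemma inner_expand y v s : U y -> inner (g y) v s =
  \sum_p \sum_q v p * (s q * inner (g y) (dbase R p.1 p.2) (dbase R q.1 q.2)).
Proof.
move=> Uy; rewrite {1}(dform_expand v) inner_suml; apply: eq_bigr => p _.
rewrite innerZl {1}(dform_expand s) inner_sumr mulr_sumr; apply: eq_bigr => q _.
by rewrite innerZr.
Qed.

Lemma smooth_inner w t : smooth_form w -> smooth_form t ->
  smooth_on U (fun y => inner (g y) (w y) (t y)).
Proof.
move=> sw st; apply: (@smooth_eq_on _ _ _ U_open (fun y => \sum_p \sum_q w y p *
    (t y q * inner (g y) (dbase R p.1 p.2) (dbase R q.1 q.2)))).
  by move=> y Uy; rewrite -inner_expand.
apply: smooth_sum => // p _; apply: smooth_sum => // q _.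
by apply: smoothM => //; apply: smoothM => //; have [] := inner_cst (dbase R p.1 p.2) (dbase R q.1 q.2).
Qed.

(** Bilinearity and the product rule reduce this to constant coefficients. *)
Lemma partial_inner a w t x : smooth_form w -> smooth_form t -> U x ->
  partial a (fun y => inner (g y) (w y) (t y)) x =
  inner (g x) (nabla g a w x) (t x) + inner (g x) (w x) (nabla g a t x).
Proof.
move=> sw st Ux; pose e (p : {set 'I_n} * {set 'I_n}) : dform R n := dbase R p.1 p.2.
pose I p q y := inner (g y) (e p) (e q).
have sI p q : smooth_on U (I p q) by have [] := inner_cst (e p) (e q).
have sp p q : smooth_on U (fun y => w y p * (t y q * I p q y)).
  by apply: smoothM => //; apply: smoothM.
rewrite (partial_eq_on U_open a (h := fun y => \sum_p \sum_q w y p * (t y q * I p q y))) //;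
  last by move=> y; apply: inner_expand.
rewrite partial_bigsum => [|p _]; last first.
  by apply: diffU => //; apply: smooth_sum.
transitivity (\sum_p \sum_q (dpartial a w x p * (t x q * I p q x)
   + w x p * (dpartial a t x q * I p q x)
   + w x p * (t x q * (- inner (g x) (connection a x (e p)) (e q)
      - inner (g x) (e p) (connection a x (e q)))))).
  apply: eq_bigr => p _; rewrite partial_bigsum => [|q _]; last exact: diffU.
  apply: eq_bigr => q _; rewrite partialM; [|exact: diffU|].
    rewrite partialM; [|exact: diffU|exact: diffU].
    by have [_ ->//] := inner_cst (e p) (e q); rewrite !dpartialE; ring.
  by apply: differentiableM; apply: diffU.
rewrite !nablaE innerDl innerDr innerNl innerNr.
rewrite (inner_expand (dpartial a w x)) // (inner_expand (w x) (dpartial a t x)) //.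
have -> : inner (g x) (connection a x (w x)) (t x) =
    \sum_p \sum_q w x p * (t x q * inner (g x) (connection a x (e p)) (e q)).
  rewrite {1}(dform_expand (w x)) connection_sum inner_suml; apply: eq_bigr => p _ /=.
  rewrite connectionZ innerZl {1}(dform_expand (t x)) inner_sumr mulr_sumr.
  by apply: eq_bigr => q _; rewrite innerZr.
have -> : inner (g x) (w x) (connection a x (t x)) =
    \sum_p \sum_q w x p * (t x q * inner (g x) (e p) (connection a x (e q))).
  rewrite {1}(dform_expand (w x)) inner_suml; apply: eq_bigr => p _ /=.
  rewrite innerZl {1}(dform_expand (t x)) connection_sum inner_sumr mulr_sumr.
  by apply: eq_bigr => q _; rewrite /= connectionZ innerZr.
rewrite -!sumrN -!big_split; apply: eq_bigr => p _ /=.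
rewrite -!sumrN -!big_split; apply: eq_bigr => q _ /=.
by rewrite /I; ring.
Qed.

(** * The differential and the codifferential *)

(** The dual bases in the definition of D cancel out. *)
Lemma D_formE w x : U x -> D_form g w x = \sum_a dmul (dl a) (nabla g a w x).
Proof.
move=> Ux; have uE := onb_unit (g_pos Ux).
transitivity (\sum_a \sum_b (\sum_i onb (g x) a i * invmx (onb (g x)) i b) *:
    dmul (dl b) (nabla g a w x)).
  rewrite /D_form; under eq_bigr => i _.
    rewrite covlE /nabla_onb.
    under eq_bigr => b _ do rewrite dmul_sumr scaler_sumr.
    rewrite exchange_big /=.
    over.
  rewrite exchange_big; apply: eq_bigr => a _ /=.
  rewrite exchange_big; apply: eq_bigr => b _ /=.
  rewrite scaler_suml; apply: eq_bigr => i _.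
  by rewrite dmulZr scalerA mxE mulrC.
apply: eq_bigr => a _; rewrite -[RHS](@sum_delta _ _ _ a (fun b => dmul (dl b) (nabla g a w x))).
apply: eq_bigr => b _; congr (_ *: _).
by have /matrixP/(_ a b) := mulmxV uE; rewrite !mxE.
Qed.

Lemma D_form_eq_on w t x : (forall y, U y -> w y = t y) -> U x ->
  D_form g w x = D_form g t x.
Proof.
by move=> wt Ux; rewrite (D_formE w Ux) (D_formE t Ux); apply: eq_bigr => a _; rewrite (nabla_eq_on a wt Ux).
Qed.

(** The basis and its dual cancel out; G^-1 comes from [iota_covl]. *)
Lemma delta_formE w x : U x ->
  delta_form g w x = - \sum_a \sum_b H x a b *: contrl b (nabla g a w x).
Proof.
move=> Ux; have gx := g_pos Ux; have uE := onb_unit gx; congr (- _).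
transitivity (\sum_a \sum_c (\sum_i onb (g x) a i * invmx (onb (g x)) i c) *:
    \sum_b H x c b *: contrl b (nabla g a w x)).
  under eq_bigr => i _.
    rewrite iota_covl // /nabla_onb.
    under eq_bigr => c _.
      under eq_bigr => b _ do rewrite linear_sum scaler_sumr /=.
      rewrite exchange_big scaler_sumr /=.
      over.
    rewrite exchange_big /=.
    over.
  rewrite exchange_big; apply: eq_bigr => a _ /=.
  rewrite exchange_big; apply: eq_bigr => c _ /=.
  rewrite scaler_suml; apply: eq_bigr => i _; rewrite mxE !scaler_sumr.
  by apply: eq_bigr => b _; rewrite contrlZ !scalerA; congr (_ *: _); ring.
apply: eq_bigr => a _.
rewrite -[RHS](@sum_delta _ _ _ a (fun c => \sum_b H x c b *: contrl b (nabla g a w x))).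
apply: eq_bigr => b _; congr (_ *: _).
by have /matrixP/(_ a b) := mulmxV uE; rewrite !mxE.
Qed.

Lemma delta_form_eq_on w t x : (forall y, U y -> w y = t y) -> U x ->
  delta_form g w x = delta_form g t x.
Proof.
move=> wt Ux; rewrite (delta_formE w Ux) (delta_formE t Ux); congr (- _).
by apply: eq_bigr => a _; rewrite (nabla_eq_on a wt Ux).
Qed.

Lemma dl_mul_comm a p q v s : bidegree p q v ->
  dmul (dl a) (dmul v s) = (-1) ^+ p *: dmul v (dmul (dl a) s).
Proof.
move=> hv; rewrite !dmulA (dl_comm a hv) dmulZl scalerA.
by rewrite -expr2 sqrr_sign scale1r.
Qed.

Lemma D_form_mul p q w t x : smooth_form w -> smooth_form t -> U x ->
  bidegree p q (w x) -> D_form g (fun y => dmul (w y) (t y)) x =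
  dmul (D_form g w x) (t x) + (-1) ^+ p *: dmul (w x) (D_form g t x).
Proof.
move=> sw st Ux hw; rewrite !D_formE // dmul_suml dmul_sumr scaler_sumr -big_split.
apply: eq_bigr => a _; rewrite nabla_mul // dmulDr dmulA; congr (_ + _).
exact: dl_mul_comm hw.
Qed.

Lemma delta_adjoint w s x : U x -> inner (g x) (delta_form g w x) s =
  - \sum_a inner (g x) (nabla g a w x) (dmul (dl a) s).
Proof.
move=> Ux; have gx := g_pos Ux; rewrite delta_formE // innerNl inner_suml; congr (- _).
apply: eq_bigr => a _; rewrite inner_suml [RHS]innerC inner_dl //.
by apply: eq_bigr => b _; rewrite innerZl innerC.
Qed.

(** Differentiate n! <e T + c g^m, s> = <g^n, T s> for a constant form s.  The
    terms in which nabla_a hits s cancel by the same identity with nabla_a s in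
    place of s, and nabla_a g = 0. *)
Lemma star_nabla T (e c : R) (m : nat) a x : smooth_form T ->
  (forall y, U y -> dstar (g y) (T y) = e *: T y + c *: dpow (gform y) m) ->
  U x -> dstar (g x) (nabla g a T x) = e *: nabla g a T x.
Proof.
move=> sT starT Ux; have gx := g_pos Ux; apply: (inner_inj gx) => s.
pose S y := e *: T y + c *: dpow (gform y) m.
have sS : smooth_form S.
  apply: smooth_formD; apply: smooth_formZ => //; first exact: smooth_cst.
    exact: smooth_cst.
  exact: smooth_metric_pow.
have nS : nabla g a S x = e *: nabla g a T x.
  rewrite /S nablaD //; [|by apply: smooth_formZ => //; apply: smooth_cst|].
    rewrite !nablaZ //; [|exact: smooth_cst|exact: smooth_metric_pow|exact: smooth_cst].
    by rewrite !partial_cst !scale0r !add0r nabla_metric_pow // scaler0 addr0.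
  by apply: smooth_formZ; [exact: smooth_cst|exact: smooth_metric_pow].
have key y : U y -> inner (g y) (S y) s =
    n`!%:R^-1 * inner (g y) (dpow (gform y) n) (dmul (T y) s).
  by move=> Uy; rewrite /S -starT // inner_star //; apply: g_pos.
have ss := smooth_form_cst s.
have := partial_eq_on U_open a key Ux.
have sTs : smooth_form (fun y => dmul (T y) s) by apply: smooth_form_mul.
rewrite partialM; [|exact: differentiable_cst|]; last first.
  by apply: diffU => //; apply: smooth_inner => //; apply: smooth_metric_pow.
rewrite partial_cst mul0r add0r partial_inner // partial_inner //; last exact: smooth_metric_pow.
rewrite nabla_metric_pow // inner0l add0r nabla_mul // innerDr mulrDr.
rewrite -(inner_star gx (T x)) starT // => /addIr E.
by rewrite inner_star // -E nS.
Qed.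

(** By adjunction, n! e <delta T, s> = - sum_a n! e <nabla_a T, dx^a s>, that is
    - sum_a <g^n, nabla_a T dx^a s> = (-1)^(p + 1) <g^n, (D T) s> = 0. *)
Lemma star_delta T (e c : R) (m p q : nat) x : e != 0 -> smooth_form T ->
  (forall y, U y -> bidegree p q (T y)) ->
  (forall y, U y -> dstar (g y) (T y) = e *: T y + c *: dpow (gform y) m) ->
  U x -> D_form g T x = 0 -> delta_form g T x = 0.
Proof.
move=> e0 sT hT starT Ux DT0; have gx := g_pos Ux.
apply: (inner_inj gx) => s; rewrite inner0l delta_adjoint //.
apply: (mulfI e0); rewrite mulr0 mulrN mulr_sumr.
transitivity (- (n`!%:R^-1 * ((-1) ^+ p * inner (g x) (dpow (gform x) n)
    (dmul (D_form g T x) s)))); last first.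
  by rewrite DT0 dmul0l innerC inner0l !mulr0 oppr0.
congr (- _); rewrite D_formE // dmul_suml inner_sumr !mulr_sumr.
apply: eq_bigr => a _; rewrite -innerZl -(star_nabla a sT starT Ux) inner_star //.
rewrite -dmulA (dl_mul_comm a s (bidegree_nabla a hT Ux)) innerZr.
by rewrite [_ * (_ * inner _ _ _)]mulrA -expr2 sqrr_sign mul1r.
Qed.

Lemma D_form_metric_mul w x : smooth_form w -> U x ->
  D_form g (fun y => dmul (gform y) (w y)) x = - dmul (gform x) (D_form g w x).
Proof.
move=> sw Ux; rewrite (D_form_mul smooth_metric_form sw Ux (bidegree_metric _)).
rewrite (_ : D_form g (fun y => gform y) x = 0); last first.
  by rewrite D_formE // big1 // => a _; rewrite nabla_metric // dmul0r.
by rewrite dmul0l add0r expr1 scaleN1r.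
Qed.

Lemma D_form_metric_pow_mul (m : nat) w x : smooth_form w -> U x ->
  D_form g (fun y => dmul (dpow (gform y) m) (w y)) x =
  (-1) ^+ m *: dmul (dpow (gform x) m) (D_form g w x).
Proof.
move=> sw Ux; elim: m => [|m IH].
  rewrite expr0 scale1r dmul1l; congr (D_form g _ x).
  by apply/funext => y; rewrite dmul1l.
transitivity (D_form g (fun y => dmul (gform y) (dmul (dpow (gform y) m) (w y))) x).
  by congr (D_form g _ x); apply/funext => y; rewrite dmulA.
rewrite D_form_metric_mul //; last by apply: smooth_form_mul => //; apply: smooth_metric_pow.
by rewrite IH dmulZr dmulA exprS mulN1r scaleNr.
Qed.

(** The left-hand side is thus the differential in the second factor. *)
Lemma D_form_swap w x : U x ->
  dswap (D_form g (fun y => dswap (w y)) x) = \sum_a dmul (dr a) (nabla g a w x).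
Proof.
move=> Ux; rewrite D_formE // linear_sum; apply: eq_bigr => a _.
by rewrite /= dswap_dl nabla_swap dswapK.
Qed.

(** This is [contrl_metric] applied to each nabla_a w, as g is parallel. *)
Lemma delta_form_metric_mul w x : smooth_form w -> U x ->
  delta_form g (fun y => dmul (gform y) (w y)) x =
  - dswap (D_form g (fun y => dswap (w y)) x) - dmul (gform x) (delta_form g w x).
Proof.
move=> sw Ux; have gx := g_pos Ux.
rewrite D_form_swap // !delta_formE // dmulNr -opprD; congr (- _).
rewrite dmul_sumr -sumrB; apply: eq_bigr => a _.
rewrite -(@sum_delta _ _ _ a (fun j => dmul (dr j) (nabla g a w x))).
under eq_bigr => b _.
  rewrite nabla_mul // ?nabla_metric // ?dmul0l ?add0r; last exact: smooth_metric_form.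
  rewrite contrl_metric // scalerBr scaler_sumr.
  over.
rewrite sumrB exchange_big dmul_sumr /=; congr (_ - _); last first.
  by apply: eq_bigr => b _; rewrite dmulZr.
apply: eq_bigr => j _; rewrite -(inv_metricK gx) scaler_suml.
by apply: eq_bigr => b _; rewrite scalerA.
Qed.

Lemma delta_form_metric_pow_mul (m : nat) w : smooth_form w ->
  (forall x, U x -> D_form g (fun y => dswap (w y)) x = 0) ->
  forall x, U x -> delta_form g (fun y => dmul (dpow (gform y) m) (w y)) x =
    (-1) ^+ m *: dmul (dpow (gform x) m) (delta_form g w x).
Proof.
move=> sw Dw0 x Ux; elim: m => [|m IH].
  rewrite expr0 scale1r dmul1l; congr (delta_form g _ x).
  by apply/funext => y; rewrite dmul1l.
transitivity (delta_form g (fun y => dmul (gform y) (dmul (dpow (gform y) m) (w y))) x).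
  by congr (delta_form g _ x); apply/funext => y; rewrite dmulA.
have sgw : smooth_form (fun y => dmul (dpow (gform y) m) (w y)).
  by apply: smooth_form_mul => //; apply: smooth_metric_pow.
have ssw : smooth_form (fun y => dswap (w y)).
  by move=> -[A B]; apply: smooth_eq_on (sw (B, A)) => // y _; rewrite dswapE.
rewrite delta_form_metric_mul // IH dmulZr dmulA exprS mulN1r scaleNr.
rewrite (D_form_eq_on (t := fun y => dmul (dpow (gform y) m) (dswap (w y)))) //.
  by rewrite D_form_metric_pow_mul // Dw0 // dmul0r scaler0 linear0 oppr0 add0r.
by move=> y Uy; rewrite dswap_mul dswap_metric_pow //; apply: g_pos.
Qed.

(** * Symmetries of the curvature *)

Lemma smooth_curvature d c a b : smooth_on U (curvature g d c a b).
Proof.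
have sG c' a' b' := smooth_christoffel c' a' b'.
apply: smoothD => //; last first.
  apply: smooth_sum => // m _; apply: smoothD => //; first exact: smoothM.
  by apply: smoothN => //; apply: smoothM.
apply: smoothD => //; first exact: smooth_partial.
by apply: smoothN => //; apply: smooth_partial.
Qed.

Lemma curvature_antisym d c a b x : curvature g d c b a x = - curvature g d c a b x.
Proof.
rewrite /curvature opprD opprB -sumrN; congr (_ + _).
by apply: eq_bigr => m _; rewrite opprB.
Qed.

Definition lowered_curvature k l i j x : R := \sum_m g x k m * curvature g m l i j x.

(** Moving the metric inside the derivatives of the Christoffel symbols produces
    derivatives of the metric, hence two families of quadratic terms; one of them
    cancels the quadratic terms of the curvature. *)
Lemma lowered_curvatureE k l i j x : U x -> lowered_curvature k l i j x =
  partial i (christoffel1 k j l) x - partial j (christoffel1 k i l) x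
  - \sum_c christoffel1 c i k x * Gam c j l x
  + \sum_c christoffel1 c j k x * Gam c i l x.
Proof.
move=> Ux; have sG c' a' b' := smooth_christoffel c' a' b'.
have der a b : \sum_m g x k m * partial a (Gam m b l) x =
    partial a (christoffel1 k b l) x
    - \sum_c christoffel1 k a c x * Gam c b l x - \sum_c christoffel1 c a k x * Gam c b l x.
  have -> : partial a (christoffel1 k b l) x =
      \sum_m (partial a (fun y => g y k m) x * Gam m b l x + g x k m * partial a (Gam m b l) x).
    rewrite /christoffel1 partial_bigsum => [|m _]; last first.
      by apply: diffU => //; apply: smoothM.
    by apply: eq_bigr => m _; rewrite partialM //; apply: diffU.
  rewrite -!sumrB; apply: eq_bigr => m _; rewrite metric_compat //.
  have E (p q r s : R) : s = (p + q) * r + s - p * r - q * r by ring.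
  exact: E.
have quad a b : \sum_m g x k m * (\sum_c Gam m a c x * Gam c b l x) =
    \sum_c christoffel1 k a c x * Gam c b l x.
  under eq_bigr => m _ do rewrite mulr_sumr.
  rewrite exchange_big; apply: eq_bigr => c _ /=; rewrite mulr_suml.
  by apply: eq_bigr => m _; rewrite mulrA.
transitivity (\sum_m g x k m * partial i (Gam m j l) x
   - \sum_m g x k m * partial j (Gam m i l) x
   + \sum_m g x k m * (\sum_c Gam m i c x * Gam c j l x)
   - \sum_m g x k m * (\sum_c Gam m j c x * Gam c i l x)).
  rewrite -sumrB -big_split -sumrB; apply: eq_bigr => m _ /=.
  rewrite /curvature sumrB.
  have E (u p q r s : R) : u * (p - q + (r - s)) = u * p - u * q + u * r - u * s by ring.
  exact: E.
have E (u1 u2 u3 u4 p q r s t v : R) : u1 = p - r - s -> u2 = q - t - v ->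
    u3 = r -> u4 = t -> u1 - u2 + u3 - u4 = p - q - s + v.
  by move=> -> -> -> ->; ring.
exact: E (der i j) (der j i) (quad i j) (quad j i).
Qed.

Lemma partial_christoffel1 i k j l x : U x -> partial i (christoffel1 k j l) x =
  2^-1 * (partial i (partial j (fun y => g y k l)) x
    + partial i (partial l (fun y => g y k j)) x
    - partial i (partial k (fun y => g y j l)) x).
Proof.
move=> Ux; have sp a b c : smooth_on U (partial a (fun y => g y b c)).
  by apply: smooth_partial.
have dp a b c : differentiable (partial a (fun y => g y b c)) x by apply: diffU.
rewrite (partial_eq_on U_open i (fun y Uy => christoffel1E k j l Uy) Ux).
rewrite partialM; [|exact: differentiable_cst|]; last first.
  apply: diffU => //; apply: smoothD => //; first exact: smoothD.
  exact: smoothN.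
rewrite partial_cst mul0r add0r; congr (_ * _).
rewrite partialD; [|by apply: differentiableD|by apply: differentiableN].
by rewrite partialD // partialN.
Qed.

(** The curvature is a sum of second derivatives of the metric and of scalar
    products of the vectors with components Gamma_ab; both parts are visibly
    invariant under the exchange of the pairs. *)
Lemma lowered_curvature_sym k l i j x : U x ->
  lowered_curvature k l i j x = lowered_curvature i j k l x.
Proof.
move=> Ux; rewrite (lowered_curvatureE k l i j Ux) (lowered_curvatureE i j k l Ux).
rewrite (partial_christoffel1 i k j l Ux) (partial_christoffel1 j k i l Ux).
rewrite (partial_christoffel1 k i l j Ux) (partial_christoffel1 l i k j Ux).
have gC a b c d : partial a (partial b (fun y => g y c d)) x =
    partial a (partial b (fun y => g y d c)) x.
  by apply: (partial_eq_on U_open) => // y Uy; apply: partial_metricC.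
have pC a b c d : partial a (partial b (fun y => g y c d)) x =
    partial b (partial a (fun y => g y c d)) x by apply: (partialC U_open).
have bil a b c d : \sum_m christoffel1 m a b x * Gam m c d x =
    \sum_m christoffel1 m c d x * Gam m a b x.
  rewrite /christoffel1; under eq_bigr => m _ do rewrite mulr_suml.
  rewrite exchange_big; apply: eq_bigr => m _ /=; rewrite mulr_suml.
  by apply: eq_bigr => e _; rewrite (metricC (g_pos Ux) e m); ring.
have GC c a b : Gam c a b x = Gam c b a x by apply: christoffelC.
have c1C c a b : christoffel1 c a b x = christoffel1 c b a x.
  by apply: eq_bigr => m _; rewrite GC.
rewrite (pC i j k l) (gC i k j l) (gC j k i l) (pC k l i j) (gC k i l j).
rewrite (pC k i j l) (pC l i k j) (pC l j i k) (gC k j i l) (pC k j l i).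
rewrite (gC j l k i) (gC j k l i) (gC i k l j).
have -> : \sum_c christoffel1 c i k x * Gam c j l x = \sum_c christoffel1 c k i x * Gam c l j x.
  by apply: eq_bigr => c _; rewrite c1C GC.
have -> : \sum_c christoffel1 c j k x * Gam c i l x = \sum_c christoffel1 c l i x * Gam c k j x.
  by rewrite bil; apply: eq_bigr => c _; rewrite c1C GC.
have E (p q r s t u v w : R) : 2^-1 * (p + q - r) - 2^-1 * (p + s - t) - v + w =
    2^-1 * (u + t - r) - 2^-1 * (u + s - q) - v + w by ring.
exact: E.
Qed.

Lemma lowered_curvature_antisym_r k l i j x :
  lowered_curvature k l j i x = - lowered_curvature k l i j x.
Proof.
rewrite /lowered_curvature -sumrN; apply: eq_bigr => m _.
by rewrite curvature_antisym mulrN.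
Qed.

(** From antisymmetry in the other pair, by pair symmetry. *)
Lemma lowered_curvature_antisym_l k l i j x : U x ->
  lowered_curvature l k i j x = - lowered_curvature k l i j x.
Proof.
move=> Ux; rewrite (lowered_curvature_sym l k i j Ux) (lowered_curvature_sym k l i j Ux).
exact: lowered_curvature_antisym_r.
Qed.

Definition lpair i j : dform R n := dmul (dl i) (dl j).
Definition rpair k l : dform R n := dmul (dr k) (dr l).

Lemma lpairC i j : lpair i j = - lpair j i.
Proof. by have := dl_dl i j (dunit R n); rewrite !dmul1r. Qed.

Lemma rpairC i j : rpair i j = - rpair j i.
Proof. by have := dr_dr i j (dunit R n); rewrite !dmul1r. Qed.

Lemma dswap_lpair i j : dswap (lpair i j) = rpair i j.
Proof. by rewrite dswap_dl dswap_base. Qed.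

Lemma lpair_rpair i j k l : dmul (lpair i j) (rpair k l) = dmul (rpair k l) (lpair i j).
Proof.
rewrite -[LHS]dmulA (dl_dr j k) (dl_dr i k) -[RHS]dmulA; congr (dmul (dr k) _).
by rewrite -dl_dr; congr (dmul _ _); have := dl_dr j l (dunit R n); rewrite !dmul1r.
Qed.

(** Summing over all indices counts every pair of pairs four times. *)
Lemma riemann_formE x : U x -> riemann_form g x =
  4^-1 *: \sum_i \sum_j \sum_k \sum_l
    lowered_curvature k l i j x *: dmul (lpair i j) (rpair k l).
Proof.
move=> Ux; pose X i j k l := lowered_curvature k l i j x *: dmul (lpair i j) (rpair k l).
have base2 i j k l : (i < j)%N -> (k < l)%N ->
    dbase R [set i; j] [set k; l] = dmul (lpair i j) (rpair k l).
  move=> ij kl; have ep a b : (a < b)%N -> eps R [set a] [set b] = 1.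
    move=> ab; rewrite /eps disjoints1 inE wsign11 -val_eqE /=.
    by rewrite ltn_eqF // ltnNge ltnW.
  by rewrite /lpair /rpair dl_base dr_base !ep // !scale1r dmul_base eps0l eps0r mulr1 scale1r set0U setU0.
transitivity (\sum_(i < n) \sum_(j < n | (i < j)%N) \sum_(k < n) \sum_(l < n | (k < l)%N) X i j k l).
  apply: eq_bigr => i _; apply: eq_bigr => j ij; apply: eq_bigr => k _.
  by apply: eq_bigr => l kl; rewrite base2.
have -> : (4 : R)^-1 = 2^-1 * 2^-1 by field.
have two_signs (c c' : R) (v v' : dform R n) : c' = - c -> v' = - v -> c *: v = c' *: v'.
  by move=> -> ->; rewrite scaleNr scalerN opprK.
have Xr i j k l : X i j k l = X i j l k.
  apply: two_signs (lowered_curvature_antisym_l k l i j Ux) _.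
  by rewrite (rpairC l k) dmulNr.
have Xl i j k l : X i j k l = X j i k l.
  apply: two_signs (lowered_curvature_antisym_r k l i j x) _.
  by rewrite (lpairC j i) dmulNl.
have Xr0 i j k : X i j k k = 0.
  by rewrite /X (eq_opp0 (rpairC k k)) dmul0r scaler0.
have Xl0 i k l : X i i k l = 0.
  by rewrite /X (eq_opp0 (lpairC i i)) dmul0l scaler0.
transitivity (2^-1 *: \sum_i \sum_j \sum_(k < n) \sum_(l < n | (k < l)%N) X i j k l).
  apply: (sum_ltn_half (F := fun i j => \sum_(k < n) \sum_(l < n | (k < l)%N) X i j k l)).
    by move=> i j; apply: eq_bigr => k _; apply: eq_bigr => l _; apply: Xl.
  by move=> i; rewrite big1 // => k _; rewrite big1.
rewrite -scalerA; congr (_ *: _); rewrite scaler_sumr; apply: eq_bigr => i _.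
rewrite scaler_sumr; apply: eq_bigr => j _.
exact: (sum_ltn_half (Xr i j) (Xr0 i j)).
Qed.

Lemma dswap_riemann x : U x -> dswap (riemann_form g x) = riemann_form g x.
Proof.
move=> Ux; rewrite riemann_formE // dswapZ; congr (_ *: _).
transitivity (\sum_i \sum_j \sum_k \sum_l
    lowered_curvature i j k l x *: dmul (lpair k l) (rpair i j)).
  rewrite linear_sum; apply: eq_bigr => i _; rewrite linear_sum; apply: eq_bigr => j _.
  rewrite linear_sum; apply: eq_bigr => k _; rewrite linear_sum; apply: eq_bigr => l _ /=.
  rewrite dswapZ dswap_mul dswap_lpair -(dswap_lpair k l) dswapK -lpair_rpair.
  by rewrite (lowered_curvature_sym k l i j Ux).
exact: (sum4_swap (fun i j k l => lowered_curvature i j k l x *: dmul (lpair k l) (rpair i j))).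
Qed.

Lemma smooth_riemann : smooth_form (riemann_form g).
Proof.
apply: smooth_form_sum => i _; apply: smooth_form_sum => j _.
apply: smooth_form_sum => k _; apply: smooth_form_sum => l _.
apply: smooth_formZ; last exact: smooth_form_cst.
by apply: smooth_sum => // m _; apply: smoothM => //; apply: smooth_curvature.
Qed.

Lemma bidegree_riemann x : bidegree 2 2 (riemann_form g x).
Proof.
apply: bidegree_sum => i _; apply: bidegree_sum => j ij.
apply: bidegree_sum => k _; apply: bidegree_sum => l kl; apply: bidegreeZ.
have := @bidegree_base R n [set i; j] [set k; l].
by rewrite !cards2 -!val_eqE /= (ltn_eqF ij) (ltn_eqF kl).
Qed.

(** * The second Bianchi identity *)

Lemma D_form_scale (f : 'rV[R]_n -> R) w x : smooth_on U f -> smooth_form w -> U x ->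
  D_form g (fun y => f y *: w y) x =
  \sum_a partial a f x *: dmul (dl a) (w x) + f x *: D_form g w x.
Proof.
move=> sf sw Ux; rewrite !D_formE // scaler_sumr -big_split; apply: eq_bigr => a _ /=.
by rewrite nablaZ // dmulDr !dmulZr.
Qed.

Lemma D_formD w t x : smooth_form w -> smooth_form t -> U x ->
  D_form g (fun y => w y + t y) x = D_form g w x + D_form g t x.
Proof.
move=> sw st Ux; rewrite (D_formE w Ux) (D_formE t Ux) D_formE // -big_split.
by apply: eq_bigr => a _; rewrite (nablaD a sw st Ux) dmulDr.
Qed.

Lemma D_form_sum (T : Type) (r : seq T) (P : pred T) (F : T -> 'rV[R]_n -> dform R n) x :
  (forall p, P p -> smooth_form (F p)) -> U x ->
  D_form g (fun y => \sum_(p <- r | P p) F p y) x =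
  \sum_(p <- r | P p) D_form g (F p) x.
Proof.
move=> sF Ux; rewrite D_formE //.
under eq_bigr => a _ do rewrite nabla_sum // dmul_sumr.
by rewrite exchange_big; apply: eq_bigr => p _; rewrite D_formE.
Qed.

(** This is the absence of torsion: the Christoffel symbols are symmetric. *)
Lemma D_form_dl i x : U x -> D_form g (fun=> dl i) x = 0.
Proof.
move=> Ux; rewrite D_formE //.
transitivity (- \sum_a \sum_b Gam i a b x *: lpair a b).
  rewrite -sumrN; apply: eq_bigr => a _; rewrite nabla_cst dmulNr; congr (- _).
  rewrite -[dl i]dmul1r connection_dl connection_unit dmul0r addr0 dmul_sumr.
  by apply: eq_bigr => b _; rewrite dmulZr dmul1r.
rewrite antisym_sum0 ?oppr0 // => a b.
by rewrite christoffelC // lpairC scalerN.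
Qed.

Lemma bidegree_dl1 i : bidegree 1 0 (dl i).
Proof. by have := @bidegree_base R n [set i] set0; rewrite cards1 cards0. Qed.

Lemma D_form_lpair i j x : U x -> D_form g (fun=> lpair i j) x = 0.
Proof.
move=> Ux; have h := D_form_mul (smooth_form_cst (dl i)) (smooth_form_cst (dl j)) Ux
  (bidegree_dl1 i).
by rewrite /lpair h !D_form_dl // dmul0l dmul0r scaler0 addr0.
Qed.

(** The connection forms omega^m_l and the curvature forms Omega^m_l of Cartan's
    structure equations, as double forms of bidegree (1, 0) and (2, 0); on these
    D is the de Rham differential. *)
Definition conn_form m l x : dform R n := \sum_i Gam m i l x *: dl i.
Definition curv_form m l x : dform R n :=
  D_form g (conn_form m l) x + \sum_c dmul (conn_form m c x) (conn_form c l x).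

Lemma smooth_conn_form m l : smooth_form (conn_form m l).
Proof.
apply: smooth_form_sum => i _; apply: smooth_formZ; last exact: smooth_form_cst.
exact: smooth_christoffel.
Qed.

Lemma D_conn_form m l x : U x ->
  D_form g (conn_form m l) x = \sum_i \sum_a partial a (Gam m i l) x *: lpair a i.
Proof.
move=> Ux; rewrite D_form_sum // => [|i _]; last first.
  by apply: smooth_formZ; [exact: smooth_christoffel | exact: smooth_form_cst].
apply: eq_bigr => i _; rewrite D_form_scale //; last 1 first.
- exact: smooth_form_cst.
- by rewrite D_form_dl // scaler0 addr0.
- exact: smooth_christoffel.
Qed.

Lemma smooth_D_conn_form m l : smooth_form (D_form g (conn_form m l)).
Proof.
apply: (@smooth_form_eq (fun x => \sum_i \sum_a partial a (Gam m i l) x *: lpair a i)).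
  by move=> y Uy; rewrite D_conn_form.
apply: smooth_form_sum => i _; apply: smooth_form_sum => a _.
apply: smooth_formZ; last exact: smooth_form_cst.
by apply: smooth_partial => //; apply: smooth_christoffel.
Qed.

Lemma D_D_conn_form m l x : U x -> D_form g (D_form g (conn_form m l)) x = 0.
Proof.
move=> Ux; rewrite (D_form_eq_on (fun y Uy => D_conn_form m l Uy) Ux).
have sG c a b : smooth_on U (Gam c a b) by apply: smooth_christoffel.
have spG a i : smooth_form (fun y => partial a (Gam m i l) y *: lpair a i).
  by apply: smooth_formZ; [exact: smooth_partial | exact: smooth_form_cst].
rewrite D_form_sum // => [|i _]; last exact: smooth_form_sum.
rewrite big1 // => i _; rewrite D_form_sum //.
transitivity (\sum_a \sum_b partial b (partial a (Gam m i l)) x *: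
    dmul (dl b) (lpair a i)).
  apply: eq_bigr => a _; rewrite D_form_scale //; last 1 first.
  - exact: smooth_form_cst.
  - by rewrite D_form_lpair // scaler0 addr0.
  - exact: smooth_partial.
apply: antisym_sum0 => a b; rewrite (partialC U_open _ _ (sG _ _ _) Ux).
by rewrite /lpair dl_dl scalerN.
Qed.

Lemma bidegree_conn_form m l x : bidegree 1 0 (conn_form m l x).
Proof.
apply: bidegree_sum => i _; apply: bidegreeZ; exact: bidegree_dl1.
Qed.

Lemma smooth_curv_form m l : smooth_form (curv_form m l).
Proof.
apply: smooth_formD; first exact: smooth_D_conn_form.
apply: smooth_form_sum => c _; apply: smooth_form_mul; exact: smooth_conn_form.
Qed.

Lemma bidegree_curv_form m l x : U x -> bidegree 2 0 (curv_form m l x).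
Proof.
move=> Ux; have h i j : bidegree 2 0 (lpair i j).
  by have := bidegree_mul (bidegree_dl1 i) (bidegree_dl1 j).
apply: bidegreeD.
  rewrite D_conn_form //; apply: bidegree_sum => i _; apply: bidegree_sum => a _.
  exact: bidegreeZ.
apply: bidegree_sum => c _.
by have := bidegree_mul (bidegree_conn_form m c x) (bidegree_conn_form c l x).
Qed.

(** Differentiate Omega = d omega + omega /\ omega; the cubic terms in omega
    cancel. *)
Lemma D_curv_form m l x : U x -> D_form g (curv_form m l) x =
  \sum_c (dmul (curv_form m c x) (conn_form c l x)
          - dmul (conn_form m c x) (curv_form c l x)).
Proof.
move=> Ux; have sw m' l' : smooth_form (conn_form m' l') by apply: smooth_conn_form.
transitivity (D_form g (fun y => \sum_c dmul (conn_form m c y) (conn_form c l y)) x).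
  have sww : smooth_form (fun y => \sum_c dmul (conn_form m c y) (conn_form c l y)).
    by apply: smooth_form_sum => c _; apply: smooth_form_mul.
  by rewrite (D_formD (smooth_D_conn_form m l) sww Ux) (D_D_conn_form m l Ux) add0r.
rewrite D_form_sum // => [|c _]; last exact: smooth_form_mul.
transitivity (\sum_c (dmul (D_form g (conn_form m c) x) (conn_form c l x)
   - dmul (conn_form m c x) (D_form g (conn_form c l) x))).
  apply: eq_bigr => c _; rewrite (D_form_mul (sw _ _) (sw _ _) Ux (bidegree_conn_form m c x)).
  by rewrite expr1 scaleN1r.
rewrite /curv_form; under [RHS]eq_bigr => c _ do rewrite dmulDl dmulDr opprD addrACA.
rewrite [RHS]big_split /= [X in _ = _ + X](_ : _ = 0) ?addr0 //.
rewrite sumrB; apply/eqP; rewrite subr_eq0; apply/eqP.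
under eq_bigr => c _ do rewrite dmul_suml.
under [RHS]eq_bigr => c _ do rewrite dmul_sumr.
rewrite exchange_big; apply: eq_bigr => c _; apply: eq_bigr => d _ /=.
by rewrite dmulA.
Qed.

Definition lowered_curv_form k l x : dform R n := \sum_m g x k m *: curv_form m l x.

Lemma smooth_lowered_curv_form k l : smooth_form (lowered_curv_form k l).
Proof.
apply: smooth_form_sum => m _; apply: smooth_formZ => //; exact: smooth_curv_form.
Qed.

Lemma bidegree_lowered_curv_form k l x : U x -> bidegree 2 0 (lowered_curv_form k l x).
Proof.
move=> Ux; apply: bidegree_sum => m _; apply: bidegreeZ; exact: bidegree_curv_form.
Qed.

(** The derivative of g_km is sum_c (g_kc omega^c_m + g_mc omega^c_k): the first
    half cancels against - omega /\ Omega in the derivative of Omega. *)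
Lemma D_lowered_curv_form k l x : U x -> D_form g (lowered_curv_form k l) x =
  \sum_c dmul (conn_form c k x) (lowered_curv_form c l x)
  + \sum_c dmul (lowered_curv_form k c x) (conn_form c l x).
Proof.
move=> Ux; rewrite D_form_sum // => [|m _]; last first.
  by apply: smooth_formZ => //; apply: smooth_curv_form.
transitivity (\sum_m \sum_a christoffel1 k a m x *: dmul (dl a) (curv_form m l x)
  + \sum_m \sum_a christoffel1 m a k x *: dmul (dl a) (curv_form m l x)
  + \sum_m g x k m *: D_form g (curv_form m l) x).
  rewrite -!big_split; apply: eq_bigr => m _ /=.
  rewrite D_form_scale //; last exact: smooth_curv_form.
  congr (_ + _); rewrite -big_split; apply: eq_bigr => a _ /=.
  by rewrite metric_compat // scalerDl.
have conn_mul c d v : dmul (conn_form c d x) v = \sum_a Gam c a d x *: dmul (dl a) v.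
  by rewrite dmul_suml; apply: eq_bigr => a _; rewrite dmulZl.
have -> : \sum_m \sum_a christoffel1 k a m x *: dmul (dl a) (curv_form m l x) =
    \sum_c g x k c *: \sum_m dmul (conn_form c m x) (curv_form m l x).
  under [RHS]eq_bigr do rewrite scaler_sumr.
  rewrite [RHS]exchange_big; apply: eq_bigr => m _ /=.
  under [RHS]eq_bigr do rewrite conn_mul scaler_sumr.
  rewrite [RHS]exchange_big; apply: eq_bigr => a _ /=; rewrite scaler_suml.
  by apply: eq_bigr => c _; rewrite scalerA.
have -> : \sum_m \sum_a christoffel1 m a k x *: dmul (dl a) (curv_form m l x) =
    \sum_c dmul (conn_form c k x) (lowered_curv_form c l x).
  under [RHS]eq_bigr do rewrite dmul_sumr.
  rewrite [RHS]exchange_big; apply: eq_bigr => m _ /=.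
  under [RHS]eq_bigr do rewrite dmulZr conn_mul scaler_sumr.
  rewrite [RHS]exchange_big; apply: eq_bigr => a _ /=; rewrite scaler_suml.
  by apply: eq_bigr => c _; rewrite scalerA (metricC (g_pos Ux)).
have -> : \sum_m g x k m *: D_form g (curv_form m l) x =
    \sum_c dmul (lowered_curv_form k c x) (conn_form c l x)
    - \sum_c g x k c *: \sum_m dmul (conn_form c m x) (curv_form m l x).
  have -> : \sum_c dmul (lowered_curv_form k c x) (conn_form c l x) =
      \sum_m g x k m *: \sum_c dmul (curv_form m c x) (conn_form c l x).
    under eq_bigr do rewrite dmul_suml.
    rewrite exchange_big; apply: eq_bigr => m _ /=; rewrite scaler_sumr.
    by apply: eq_bigr => c _; rewrite dmulZl.
  rewrite -sumrB; apply: eq_bigr => m _.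
  by rewrite D_curv_form // sumrB scalerBr.
by rewrite [LHS]addrC addrA subrK addrC.
Qed.

(** The antisymmetric part of the coefficients of Omega^m_l is half of the
    curvature. *)
Lemma riemann_form_curv x : U x -> riemann_form g x =
  2^-1 *: \sum_k \sum_l dmul (lowered_curv_form k l x) (rpair k l).
Proof.
move=> Ux; rewrite riemann_formE //.
have E m l : curv_form m l x =
    2^-1 *: \sum_i \sum_j curvature g m l i j x *: lpair i j.
  pose A i j := partial i (Gam m j l) x + \sum_c Gam m i c x * Gam c j l x.
  have -> : curv_form m l x = \sum_i \sum_j A i j *: lpair i j.
    rewrite /curv_form D_conn_form // exchange_big /=.
    have -> : \sum_c dmul (conn_form m c x) (conn_form c l x) =
        \sum_i \sum_j (\sum_c Gam m i c x * Gam c j l x) *: lpair i j.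
      under eq_bigr => c _ do rewrite dmul_suml.
      rewrite exchange_big; apply: eq_bigr => i _ /=.
      under eq_bigr => c _ do rewrite dmul_sumr.
      rewrite exchange_big; apply: eq_bigr => j _ /=; rewrite scaler_suml.
      by apply: eq_bigr => c _; rewrite dmulZl dmulZr scalerA.
    rewrite -big_split; apply: eq_bigr => i _; rewrite -big_split.
    by apply: eq_bigr => j _ /=; rewrite scalerDl.
  have curvA i j : curvature g m l i j x = A i j - A j i.
    rewrite /curvature sumrB /A; have E (p q r s : R) : p - q + (r - s) = p + r - (q + s) by ring.
    exact: E.
  have -> : \sum_i \sum_j curvature g m l i j x *: lpair i j =
      \sum_i \sum_j A i j *: lpair i j + \sum_i \sum_j A i j *: lpair i j.
    rewrite [X in _ = _ + X]exchange_big -big_split; apply: eq_bigr => i _ /=.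
    rewrite -big_split; apply: eq_bigr => j _ /=.
    by rewrite curvA scalerBl [lpair j i]lpairC scalerN.
  by rewrite scalerDr -scalerDl (_ : 2^-1 + 2^-1 = 1 :> R) ?scale1r //; field.
have -> : (4 : R)^-1 = 2^-1 * 2^-1 by field.
rewrite -scalerA; congr (_ *: _).
transitivity (\sum_i \sum_j \sum_k \sum_l \sum_m
   (2^-1 * g x k m * curvature g m l i j x) *: dmul (lpair i j) (rpair k l)).
  rewrite scaler_sumr; apply: eq_bigr => i _; rewrite scaler_sumr; apply: eq_bigr => j _.
  rewrite scaler_sumr; apply: eq_bigr => k _; rewrite scaler_sumr; apply: eq_bigr => l _.
  rewrite scalerA /lowered_curvature mulr_sumr scaler_suml; apply: eq_bigr => m _.
  by rewrite mulrA.
transitivity (\sum_k \sum_l \sum_m \sum_i \sum_j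
   (2^-1 * g x k m * curvature g m l i j x) *: dmul (lpair i j) (rpair k l)); last first.
  apply: eq_bigr => k _; apply: eq_bigr => l _; rewrite dmul_suml.
  apply: eq_bigr => m _; rewrite E dmulZl dmulZl dmul_suml !scaler_sumr.
  apply: eq_bigr => i _; rewrite dmul_suml !scaler_sumr; apply: eq_bigr => j _.
  by rewrite dmulZl !scalerA; congr (_ *: _); ring.
rewrite (sum4_swap (fun i j k l => \sum_m
   (2^-1 * g x k m * curvature g m l i j x) *: dmul (lpair i j) (rpair k l))).
apply: eq_bigr => k _; apply: eq_bigr => l _.
exact: (sum3_rot (fun i j m =>
   (2^-1 * g x k m * curvature g m l i j x) *: dmul (lpair i j) (rpair k l))).
Qed.

Lemma D_form_dr k x : U x ->
  D_form g (fun=> dr k) x = - \sum_b dmul (conn_form k b x) (dr b).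
Proof.
move=> Ux; rewrite D_formE //.
under [in RHS]eq_bigr => b _ do rewrite dmul_suml.
rewrite exchange_big -sumrN; apply: eq_bigr => a _; rewrite nabla_cst dmulNr; congr (- _).
rewrite -[dr k]dmul1r connection_dr connection_unit dmul0r addr0 dmul_sumr.
by apply: eq_bigr => b _; rewrite dmulZr dmul1r dmulZl.
Qed.

Lemma dr_conn_form k m l x v :
  dmul (dr k) (dmul (conn_form m l x) v) = dmul (conn_form m l x) (dmul (dr k) v).
Proof.
rewrite !dmul_suml dmul_sumr; apply: eq_bigr => i _.
by rewrite !dmulZl dmulZr dl_dr.
Qed.

Lemma bidegree_dr1 i : bidegree 0 1 (dr i).
Proof. by have := @bidegree_base R n set0 [set i]; rewrite cards1 cards0. Qed.

Lemma D_form_rpair k l x : U x -> D_form g (fun=> rpair k l) x =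
  - \sum_c dmul (conn_form k c x) (rpair c l) - \sum_c dmul (conn_form l c x) (rpair k c).
Proof.
move=> Ux; have h := D_form_mul (smooth_form_cst (dr k)) (smooth_form_cst (dr l)) Ux
  (bidegree_dr1 k).
rewrite /rpair h expr0 scale1r !D_form_dr // dmulNl dmulNr dmul_suml dmul_sumr.
congr (- _ - _); apply: eq_bigr => c _; first by rewrite dmulA.
by rewrite dr_conn_form.
Qed.

(** By [riemann_form_curv], R is up to a factor the sum of the products
    Phi_kl dx^k dx^l, where Phi_kl is Omega^m_l with its upper index lowered and
    dx^k, dx^l are in the second factor.  Each connection form in D (Phi_kl) is
    matched by the one coming from D (1 (x) dx^k) or D (1 (x) dx^l), after
    renaming indices. *)
Lemma D_riemann x : U x -> D_form g (riemann_form g) x = 0.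
Proof.
move=> Ux; rewrite (D_form_eq_on riemann_form_curv Ux).
have sF k l : smooth_form (fun y => dmul (lowered_curv_form k l y) (rpair k l)).
  by apply: smooth_form_mul; [exact: smooth_lowered_curv_form | exact: smooth_form_cst].
rewrite D_form_scale; [|exact: smooth_cst| |exact: Ux]; last first.
  by apply: smooth_form_sum => k _; apply: smooth_form_sum => l _.
rewrite big1 ?add0r => [|a _]; last by rewrite partial_cst scale0r.
rewrite D_form_sum // => [|k _]; last exact: smooth_form_sum.
under eq_bigr => k _ do rewrite D_form_sum //.
have wF c d k l v : dmul (conn_form c d x) (dmul (lowered_curv_form k l x) v) =
    dmul (lowered_curv_form k l x) (dmul (conn_form c d x) v).
  rewrite [LHS]dmul_suml [dmul (conn_form c d x) v]dmul_suml dmul_sumr.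
  apply: eq_bigr => a _; rewrite dmulZl dmulZl dmulZr.
  by rewrite (dl_mul_comm a v (bidegree_lowered_curv_form k l Ux)) sqrrN expr1n scale1r.
transitivity (2^-1 *: \sum_k \sum_l (
   \sum_c dmul (lowered_curv_form c l x) (dmul (conn_form c k x) (rpair k l))
   + \sum_c dmul (lowered_curv_form k c x) (dmul (conn_form c l x) (rpair k l))
   - \sum_c dmul (lowered_curv_form k l x) (dmul (conn_form k c x) (rpair c l))
   - \sum_c dmul (lowered_curv_form k l x) (dmul (conn_form l c x) (rpair k c)))).
  congr (_ *: _); apply: eq_bigr => k _; apply: eq_bigr => l _.
  rewrite (D_form_mul (smooth_lowered_curv_form k l) (smooth_form_cst (rpair k l)) Ux
    (bidegree_lowered_curv_form k l Ux)) sqrrN expr1n scale1r.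
  rewrite (D_lowered_curv_form k l Ux) (D_form_rpair k l Ux).
  rewrite [X in X + _]dmulDl [X in _ + X]dmulBr [X in _ + (X - _)]dmulNr addrA; congr (_ + _ - _ - _).
  - by rewrite dmul_suml; apply: eq_bigr => c _; rewrite -dmulA wF.
  - by rewrite dmul_suml; apply: eq_bigr => c _; rewrite -dmulA.
  - by rewrite dmul_sumr.
  - by rewrite dmul_sumr.
rewrite -[RHS](scaler0 _ 2^-1); congr (_ *: _).
exact: (sum3_cancel
  (fun k l c => dmul (lowered_curv_form k l x) (dmul (conn_form k c x) (rpair c l)))
  (fun k l c => dmul (lowered_curv_form k l x) (dmul (conn_form l c x) (rpair k c)))).
Qed.

(** * Harmonicity of the powers of the curvature *)

Lemma smooth_riemann_pow (k : nat) : smooth_form (fun y => dpow (riemann_form g y) k).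
Proof. exact: smooth_form_pow smooth_riemann. Qed.

Lemma D_form0 x : U x -> D_form g (fun=> 0) x = 0.
Proof.
move=> Ux; rewrite D_formE // big1 // => a _.
by rewrite nabla_cst linear0 oppr0 dmul0r.
Qed.

Lemma delta_form0 x : U x -> delta_form g (fun=> 0) x = 0.
Proof.
move=> Ux; rewrite delta_formE // big1 ?oppr0 // => a _; rewrite big1 // => b _.
by rewrite nabla_cst linear0 oppr0 linear0 scaler0.
Qed.

Lemma D_riemann_pow (k : nat) x : U x ->
  D_form g (fun y => dpow (riemann_form g y) k) x = 0.
Proof.
move=> Ux; elim: k => [|k IH].
  rewrite D_formE // big1 // => a _.
  by rewrite nabla_cst connection_unit oppr0 dmul0r.
transitivity (D_form g (fun y => dmul (riemann_form g y) (dpow (riemann_form g y) k)) x).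
  by [].
rewrite (D_form_mul smooth_riemann (smooth_riemann_pow k) Ux (bidegree_riemann x)).
by rewrite D_riemann // IH dmul0l dmul0r scaler0 addr0.
Qed.

Lemma dswap_riemann_pow (k : nat) x : U x ->
  dswap (dpow (riemann_form g x) k) = dpow (riemann_form g x) k.
Proof.
move=> Ux; elim: k => [|k IH]; first exact: dswap_unit.
by rewrite /dpow iterS dswap_mul dswap_riemann //; congr (dmul _ _).
Qed.

Lemma bidegree_delta p q w x : (forall y, U y -> bidegree p.+1 q (w y)) -> U x ->
  bidegree p q (delta_form g w x).
Proof.
move=> hw Ux; rewrite delta_formE //; apply: bidegreeN; apply: bidegree_sum => a _.
apply: bidegree_sum => b _; apply: bidegreeZ; apply: bidegree_contrl.
exact: bidegree_nabla.
Qed.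

(** The case e = 1, c = 0 is the Thorpe condition, the case e = -1 the anti-Thorpe
    condition. *)
Lemma harmonic_riemann_pow (p k : nat) (e c : R) :
  (1 <= k)%N -> n = (2 * p)%N -> (4 * k <= n)%N -> e != 0 ->
  (forall y, U y ->
     let T := dmul (dpow (gform y) (p - 2 * k)) (dpow (riemann_form g y) k) in
     dstar (g y) T = e *: T + c *: dpow (gform y) p) ->
  forall x, U x -> laplacian g (fun y => dpow (riemann_form g y) k) x = 0.
Proof.
move=> k1 np k4 e0 starT.
pose Rk y := dpow (riemann_form g y) k.
pose T y := dmul (dpow (gform y) (p - 2 * k)) (Rk y).
have sRk : smooth_form Rk by apply: smooth_riemann_pow.
have sT : smooth_form T by apply: smooth_form_mul => //; apply: smooth_metric_pow.
have hRk y : bidegree (k * 2) (k * 2) (Rk y) by apply: bidegree_pow; apply: bidegree_riemann.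
have hT y : bidegree ((p - 2 * k) * 1 + k * 2)%N ((p - 2 * k) * 1 + k * 2)%N (T y).
  by apply: bidegree_mul => //; apply: bidegree_pow; apply: bidegree_metric.
have DT0 x : U x -> D_form g T x = 0.
  by move=> Ux; rewrite /T D_form_metric_pow_mul // D_riemann_pow // dmul0r scaler0.
have deltaT0 x : U x -> delta_form g T x = 0.
  by move=> Ux; apply: (star_delta e0 sT (fun y _ => hT y) starT Ux (DT0 x Ux)).
have delta0 x : U x -> delta_form g Rk x = 0.
  move=> Ux; have := deltaT0 x Ux; rewrite /T delta_form_metric_pow_mul //; last first.
    move=> y Uy; rewrite (D_form_eq_on (t := Rk)) //; first exact: D_riemann_pow.
    by move=> z Uz; apply: dswap_riemann_pow.
  move=> /eqP; rewrite scaler_eq0 signr_eq0 /= => /eqP.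
  apply: (metric_pow_mul_inj (g_pos Ux) (p := (k * 2).-1) (q := k * 2)); last lia.
  apply: bidegree_delta => // y _; rewrite prednK; [exact: hRk | lia].
move=> x Ux; rewrite /laplacian (D_form_eq_on (t := fun=> 0) delta0 Ux).
rewrite (delta_form_eq_on (t := fun=> 0) _ Ux); last by move=> y Uy; apply: D_riemann_pow.
by rewrite D_form0 // delta_form0 // addr0.
Qed.

End LeviCivita.

Theorem mainTheorem10 (R : realType) (n p k : nat) (M : riemannianManifold R n)
    (k_ge1 : (1 <= k)%N) (n_even : n = (2 * p)%N) (n_ge4k : (4 * k <= n)%N)
    (hM : thorpe M p k \/ anti_thorpe M p k) :
  is_harmonic (pow_field (riemann_field M) k).
Proof.
move=> a x; have U_open := @chart_cod_open _ _ M a.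
have g_smooth := @metric_smooth _ _ M a.
have g_pos y : chart_cod a y -> posdef (metric a y).
  by move=> Uy; split=> [|v]; [exact: metric_sym | exact: metric_posdef].
have harm e c := harmonic_riemann_pow U_open g_smooth g_pos (e := e) (c := c)
  k_ge1 n_even n_ge4k.
case: hM => [hT|[c hT]].
  apply: (harm 1 0 (oner_neq0 _)) => y Uy T.
  by rewrite scale1r scale0r addr0; apply: hT.
apply: (harm (-1) c); first by rewrite oppr_eq0 oner_neq0.
move=> y Uy T; have := hT a y Uy; rewrite /scale_field /add_field => <-.
by rewrite scaleN1r addrC addrK.
Qed.
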